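(* Let $\langle \mathcal{A} \,\|\, \mathcal{R}\rangle$ be a group presentation with a finite alphabet $\mathcal{A}$ and a decidable set $\mathcal{R}$ of nonempty cyclically reduced words over $\mathcal{A}^{\pm 1}$. Then the word problem for $\langle \mathcal{A} \,\|\, \mathcal{R}\rangle$ is solvable if and only if the Dehn $1$-function $f_1(x)$ of $\langle \mathcal{A} \,\|\, \mathcal{R}\rangle$ is computable.
   Context: Presentations. $\mathcal{A}=\{a_1,\dots,a_m\}$ is a finite alphabet, $\mathcal{A}^{\pm1}=\mathcal{A}\cup\mathcal{A}^{-1}$, $F(\mathcal{A})$ is the free group over $\mathcal{A}$, and $|W|$ is the length of a word $W$ over $\mathcal{A}^{\pm1}$. The relator set $\mathcal{R}$ (possibly infinite) consists of nonempty cyclically reduced words over $\mathcal{A}^{\pm1}$; $\langle\langle\mathcal{R}\rangle\rangle$ is its normal closure in $F(\mathcal{A})$, and $\langle\mathcal{A}\,\|\,\mathcal{R}\rangle$ presents the group $F(\mathcal{A})/\langle\langle\mathcal{R}\rangle\rangle$. A word $W$ over $\mathcal{A}^{\pm1}$ is said to be in $\langle\langle\mathcal{R}\rangle\rangle$ if the element of $F(\mathcal{A})$ it represents is. The set $\mathcal{R}$ is decidable (recursive) if there is an algorithm deciding whether a given word over $\mathcal{A}^{\pm1}$ belongs to $\mathcal{R}$. The word problem is solvable if there is an algorithm deciding whether a given word over $\mathcal{A}^{\pm1}$ is in $\langle\langle\mathcal{R}\rangle\rangle$. Van Kampen diagrams. $K(\mathcal{A},\mathcal{R})$ is the standard presentation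 2-complex: one 0-cell, oriented 1-cells in bijection with the letters of $\mathcal{A}^{\pm1}$ (a letter and its inverse corresponding to opposite orientations of one 1-cell), 2-cells in bijection with the words of $\mathcal{R}$, attached along these words. A van Kampen diagram over $\langle\mathcal{A}\,\|\,\mathcal{R}\rangle$ is a planar, finite, connected and simply connected 2-complex $\Delta$ with a continuous cellular map to $K(\mathcal{A},\mathcal{R})$ whose restriction to every (open) cell is a homeomorphism onto a cell. Thus each oriented edge $e$ carries a label $\varphi(e)\in\mathcal{A}^{\pm1}$ with $\varphi(e^{-1})=\varphi(e)^{-1}$, and the boundary of each 2-cell is labeled by a cyclic permutation of a word of $\mathcal{R}$ or its inverse. The label $\varphi(p)$ of a path $p=e_1\cdots e_k$ is $\varphi(e_1)\cdots\varphi(e_k)$. $\partial\Delta$ is the boundary path of $\Delta$, $\varphi(\partial\Delta)\equiv W$ means literal equality as cyclic words, and $|\Delta(j)|$ is the number of $j$-cells of $\Delta$. By van Kampen's lemma, $W\in\langle\langle\mathcal{R}\rangle\rangle$ if and only if there is a van Kampen diagram $\Delta$ with $\varphi(\partial\Delta)\equiv W$. Dehn $j$-functions. For $W\in\langle\langle\mathcal{R}\rangle\rangle$ and $j\in\{0,1,2\}$ let $L_j(W)=\min\{|\Delta(j)| : \varphi(\partial\Delta)\equiv W\}$, the minimum over van Kampen diagrams $\Delta$ over the presentation. The Dehn $j$-function is, for integers $x\ge1$, $f_j(x)=\max\{L_j(W) : W\in\langle\langle\mathcal{R}\rangle\rangle,\ |W|\le x\}$. *)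

(* Defs.v *)
From mathcomp Require Import all_boot.

Set Implicit Arguments.
Unset Strict Implicit.
Unset Printing Implicit Defensive.

(* Recursive functions in the Kleene-Shoenfield style: the least class of total
   functions nat^n -> nat containing the initial functions and closed under
   composition, primitive recursion and minimisation of regular functions.
   Primitive recursion and minimisation are stated through the defining
   equations of the resulting function h. *)
Inductive recursive : forall n : nat, (n.-tuple nat -> nat) -> Prop :=
| rec_zero n : recursive (fun _ : n.-tuple nat => 0)
| rec_succ : recursive (fun v : 1.-tuple nat => (thead v).+1)
| rec_proj n (i : 'I_n) : recursive (fun v : n.-tuple nat => tnth v i)
| rec_comp n k (f : k.-tuple nat -> nat) (g : 'I_k -> n.-tuple nat -> nat) :
    recursive f -> (forall i, recursive (g i)) ->
    recursive (fun v : n.-tuple nat => f [tuple g i v | i < k])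
| rec_prim n (f : n.-tuple nat -> nat) (g : n.+2.-tuple nat -> nat)
    (h : n.+1.-tuple nat -> nat) :
    recursive f -> recursive g ->
    (forall v : n.-tuple nat, h [tuple of 0 :: v] = f v) ->
    (forall x (v : n.-tuple nat),
        h [tuple of x.+1 :: v] = g [tuple of x :: h [tuple of x :: v] :: v]) ->
    recursive h
| rec_mu n (f : n.+1.-tuple nat -> nat) (h : n.-tuple nat -> nat) :
    recursive f ->
    (forall v : n.-tuple nat, f [tuple of h v :: v] = 0) ->
    (forall (v : n.-tuple nat) y, y < h v -> f [tuple of y :: v] <> 0) ->
    recursive h
| rec_ext n (f g : n.-tuple nat -> nat) : f =1 g -> recursive f -> recursive g.

Definition recursive1 (f : nat -> nat) : Prop :=
  recursive (fun v : 1.-tuple nat => f (thead v)).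

(* Words over the alphabet {a_0, ..., a_(m-1)} and its inverses: the pair
   (i, false) is the letter a_i and (i, true) is its inverse. *)
Definition letter (m : nat) : Type := ('I_m * bool)%type.
Definition word (m : nat) : Type := seq (letter m).

Definition inv_letter m (x : letter m) : letter m := (x.1, ~~ x.2).
Definition inv_word m (w : word m) : word m := rev (map (@inv_letter m) w).

Definition cyclically_reduced m (w : word m) : bool :=
  cycle (fun x y : letter m => (y : 'I_m * bool) != inv_letter x) w.

(* u and v are equal as cyclic words. *)
Definition cyclic_eq m (u v : word m) : Prop := exists k, v = rot k u.

(* The Goedel number of a word: CodeSeq.code is an effective bijection from
   seq nat to nat. *)
Definition letter_code m (x : letter m) : nat := x.1.*2 + x.2.
Definition word_code m (w : word m) : nat :=
  CodeSeq.code (map (@letter_code m) w).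

Definition decidable_words m (P : word m -> Prop) : Prop :=
  exists2 chi : nat -> bool,
    recursive1 (fun x => chi x : nat) & forall w, chi (word_code w) <-> P w.

(* Two words represent the same element of the free group. *)
Inductive free_eq m : word m -> word m -> Prop :=
| free_cancel (u v : word m) (x : letter m) :
    free_eq (u ++ [:: x; inv_letter x] ++ v) (u ++ v)
| free_refl u : free_eq u u
| free_sym u v : free_eq u v -> free_eq v u
| free_trans u v w : free_eq u v -> free_eq v w -> free_eq u w.

(* normal_closure R w : the element of the free group represented by w lies in
   the least normal subgroup containing (the elements represented by) R. *)
Inductive normal_closure m (R : word m -> Prop) : word m -> Prop :=
| nc_relator r : R r -> normal_closure R r
| nc_one : normal_closure R [::]
| nc_mul u v :
    normal_closure R u -> normal_closure R v -> normal_closure R (u ++ v)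
| nc_inv u : normal_closure R u -> normal_closure R (inv_word u)
| nc_conj u v :
    normal_closure R u -> normal_closure R (v ++ u ++ inv_word v)
| nc_free u v : free_eq u v -> normal_closure R u -> normal_closure R v.

Definition solvable_word_problem m (R : word m -> Prop) : Prop :=
  decidable_words (normal_closure R).

Section EdgePaths.
Variables (vertex dart : finType) (origin : dart -> vertex).
Variables (opp face : dart -> dart) (cell : {pred dart}).

(* epath x p y : p is an edge path from x to y. *)
Fixpoint epath (x : vertex) (p : seq dart) (y : vertex) : bool :=
  if p is d :: p' then (origin d == x) && epath (origin (opp d)) p' y
  else x == y.

(* Combinatorial homotopy, with fixed endpoints x and y, of edge paths in the
   2-complex whose 2-cells are attached along the face-orbits inside cell. *)
Inductive homotopic (x y : vertex) : seq dart -> seq dart -> Prop :=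
| hom_spur p q d :
    epath x p (origin d) -> epath (origin d) q y ->
    homotopic x y (p ++ [:: d; opp d] ++ q) (p ++ q)
| hom_cell p q d :
    d \in cell -> epath x p (origin d) -> epath (origin d) q y ->
    homotopic x y (p ++ orbit face d ++ q) (p ++ q)
| hom_refl p : epath x p y -> homotopic x y p p
| hom_sym p q : homotopic x y p q -> homotopic x y q p
| hom_trans p q r :
    homotopic x y p q -> homotopic x y q r -> homotopic x y p r.

End EdgePaths.

(* Van Kampen diagrams as combinatorial maps on the sphere.  Darts are the
   oriented edges, opp reverses the orientation, and face d is the dart that
   follows d on the boundary of the region lying to the left of d, so that
   face \o opp turns around a vertex and the regions of the complement of the
   1-skeleton are the orbits of face.  The regions that are 2-cells of the
   diagram are those whose darts are in cell; since the diagram lies in the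
   plane at least one region, the unbounded one, is not a 2-cell.  A connected
   map is drawn on the sphere exactly when its Euler characteristic is 2; the
   maxn accounts for the map reduced to one vertex, which has one region but no
   dart. *)
Record diagram m (R : word m -> Prop) : Type := Diagram {
  vertex : finType;
  dart : finType;
  origin : dart -> vertex;
  opp : dart -> dart;
  face : dart -> dart;
  cell : {pred dart};
  lab : dart -> letter m;
  opp_involutive : involutive opp;
  opp_neq : forall d, opp d != d;
  face_injective : injective face;
  origin_rotation :
    forall d d', origin d = origin d' <-> fconnect (face \o opp) d d';
  cell_face : forall d, (face d \in cell) = (d \in cell);
  diagram_connected : forall x y, exists p, epath origin opp x p y;
  diagram_nonempty : 0 < #|vertex|;
  diagram_spherical : #|vertex| + maxn 1 (fcard face dart) = #|dart|./2 + 2;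
  diagram_planar : 0 < #|dart| -> exists d, d \notin cell;
  diagram_simply_connected : forall x p, epath origin opp x p x ->
    homotopic origin opp face cell x x p [::];
  lab_opp : forall d, lab (opp d) = inv_letter (lab d);
  lab_cell : forall d, d \in cell -> exists2 r, R r &
    cyclic_eq r (map lab (orbit face d)) \/
    cyclic_eq (inv_word r) (map lab (orbit face d)) }.

Section Dehn.
Variables (m : nat) (R : word m -> Prop).

Definition ncells (D : diagram R) (j : nat) : nat :=
  match j with
  | 0 => #|vertex D|
  | 1 => #|dart D|./2
  | 2 => fcard (@face _ _ D) (@cell _ _ D)
  | _ => 0
  end.

(* The boundary path runs around the unbounded region, which is on its left.
   The opposite orientation gives the same Dehn functions: a reflection of the
   plane turns a diagram into a diagram over the same presentation. *)
Definition boundary_path (D : diagram R) (p : seq (dart D)) : Prop :=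
  (#|dart D| = 0 /\ p = [::]) \/
  (exists2 d, d \notin @cell _ _ D & p = orbit (@face _ _ D) d).

Definition boundary_label (D : diagram R) (w : word m) : Prop :=
  exists2 p, boundary_path p & cyclic_eq (map (@lab _ _ D) p) w.

Definition is_min (S : nat -> Prop) (n : nat) : Prop :=
  S n /\ forall k, S k -> n <= k.
Definition is_max (S : nat -> Prop) (n : nat) : Prop :=
  S n /\ forall k, S k -> k <= n.

(* min_cells j w n : L_j(w) = n. *)
Definition min_cells (j : nat) (w : word m) : nat -> Prop :=
  is_min (fun n => exists2 D : diagram R, boundary_label D w & ncells D j = n).

(* dehn j x n : f_j(x) = n. *)
Definition dehn (j x : nat) : nat -> Prop :=
  is_max (fun n => exists w : word m,
    [/\ normal_closure R w, size w <= x & min_cells j w n]).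

Definition computable_dehn (j : nat) : Prop :=
  exists2 f : nat -> nat, recursive1 f & forall x, 1 <= x -> dehn j x (f x).

End Dehn.

(* Main.v *)
(* Take a diagram with boundary word w.  Removing an edge that separates a 2-cell
   from the outer region replaces a letter x of w by a word c such that x^-1 c is
   a cyclic permutation of a relator or of its inverse; once no 2-cell is left,
   the diagram is a tree, and removing the edge of a leaf deletes some x x^-1
   from w.  Both moves can be reversed, so w bounds a diagram with n edges if and
   only if n such moves lead from w to the empty word.  The words met on the way
   have length at most 2n, so this is decidable when R is.  Van Kampen's lemma
   says that every word of the normal closure can be reduced in this way; hence,
   if the word problem is solvable, f_1(x) is computed as the least y such that
   all trivial words of length at most x are reduced in at most y moves, and
   conversely a word is trivial if and only if it is reduced in at most
   f_1(|w|) moves. *)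

Require Import Defs.
From mathcomp Require Import all_boot zify.

Set Implicit Arguments.
Unset Strict Implicit.
Unset Printing Implicit Defensive.

(** * Van Kampen's lemma for words *)

(** That a reducible word stays reducible when some x x^-1 is deleted from it cannot be read off the
    moves, since the reduction may replace x or x^-1 through a relator. Reductions are therefore
    brought into a normal form, all cell moves before all leaf moves ([trivializes]), in which a
    whole relator can be deleted from a word; a pair with a replaced letter is a special case of
    this. For diagrams, [diagram] allows several regions outside [cell] and states simple
    connectedness through homotopy. A parity argument shows that there is just one outer region, and
    Euler's formula then forces a tree once the cells are gone. In the other direction, adding an
    edge changes the vertex rotation in a way that is awkward to follow. The intermediate
    [planar_map] keeps only data that are easy to extend by an edge, and the face permutation is
    built once, at the end. *)

Lemma cat_eq_cat (T : Type) (a b c d : seq T) :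
  a ++ b = c ++ d ->
  (exists2 e, c = a ++ e & b = e ++ d) \/ (exists2 e, a = c ++ e & d = e ++ b).
Proof.
elim: a c => [|x a IH] [|y c] /=.
- by move=> ->; left; exists [::].
- by move=> ->; left; exists (y :: c).
- by move=> <-; right; exists (x :: a).
- by case=> <- /IH[] [e -> ->]; [left | right]; exists e.
Qed.

Lemma cat_eq_cat_cons (T : Type) (a b c d : seq T) z :
  a ++ b = c ++ z :: d ->
  (exists2 e, a = c ++ z :: e & d = e ++ b) \/ (exists2 e, c = a ++ e & b = e ++ z :: d).
Proof.
case/cat_eq_cat=> [] [e]; first by right; exists e.
move=> ->; case: e => [|y e] /=; first by move=> <-; right; exists [::]; rewrite ?cats0.
by case=> <- ->; left; exists e.
Qed.

Section Words.
Variable m : nat.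
Implicit Types (x y z : letter m) (u v w : word m).

Lemma inv_letterK : involutive (@inv_letter m).
Proof. by case=> i b; rewrite /inv_letter /= negbK. Qed.

Lemma inv_wordK : involutive (@inv_word m).
Proof.
by move=> w; rewrite /inv_word map_rev revK -map_comp map_id_in // => x _ /=;
  rewrite inv_letterK.
Qed.

Lemma inv_word_cat u v : inv_word (u ++ v) = inv_word v ++ inv_word u.
Proof. by rewrite /inv_word map_cat rev_cat. Qed.

Lemma inv_word_cons x u : inv_word (x :: u) = inv_word u ++ [:: inv_letter x].
Proof. by rewrite -cat1s inv_word_cat. Qed.

(** * Words that cancel to the empty word *)

Inductive cancels : word m -> Prop :=
| cancels_nil : cancels [::]
| cancels_pair u v x :
    cancels (u ++ v) -> cancels (u ++ x :: inv_letter x :: v).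

Lemma cancels_insert u v w : cancels v -> cancels (u ++ w) -> cancels (u ++ v ++ w).
Proof.
move=> cv; elim: cv u w => [|v1 v2 x _ IH] u w; rewrite ?cat0s // => /IH.
rewrite -!catA /= (catA u v1 (v2 ++ w)) (catA u v1 (x :: _)); exact: cancels_pair.
Qed.

(* In a word that cancels, the letter z is deleted together with some z^-1,
   and everything in between must have been deleted before. *)
Lemma cancels_partner u v z : cancels (u ++ z :: v) ->
  (exists a b, [/\ u = a ++ inv_letter z :: b, cancels b & cancels (a ++ v)]) \/
  (exists a b, [/\ v = b ++ inv_letter z :: a, cancels b & cancels (u ++ a)]).
Proof.
move Ew: (u ++ z :: v) => w c; elim: c u v Ew => [|p q x cpq IH] u v Ew.
  by case: u Ew.
have [[e Ep Ev]|[e Eu]] := cat_eq_cat_cons (esym Ew).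
  subst p v.
  have [|[a [b [-> cb cav]]]|[a [b [Ee cb cua]]]] := IH u (e ++ q).
  - by rewrite -catA.
  - left; exists a, b; split=> //; rewrite catA; apply: cancels_pair.
    by rewrite -catA.
  - have [[f]|[f]] := cat_eq_cat_cons Ee.
      move=> -> Ea; subst a; right; exists (f ++ x :: inv_letter x :: q), b.
      split; rewrite -?catA //=; rewrite catA; apply: cancels_pair.
      by rewrite -catA.
    move=> Eb ->; subst b; right.
    exists a, (e ++ x :: inv_letter x :: f); split; rewrite -?catA //.
    exact: cancels_pair.
case: e Eu => [|y e] /= Eu [].
  move=> <- <-; right; exists q, [::]; split=> //; first exact: cancels_nil.
  by rewrite Eu cats0.
case: e Eu => [|y' e] /= Eu Ex [].
  move=> <- <-; left; exists p, [::]; split=> //; last exact: cancels_nil.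
  by rewrite Eu inv_letterK Ex.
move=> Ey Eq; subst u q y y'.
have [|[a [b [Ee cb cav]]]|[a [b [-> cb cua]]]] := IH (p ++ e) v.
- by rewrite -catA.
- have [[f]|[f]] := cat_eq_cat_cons Ee.
    move=> -> Eb; subst b; left; exists a, (f ++ x :: inv_letter x :: e).
    split; rewrite -?catA //; exact: cancels_pair.
  move=> Ea ->; subst a; left; exists (p ++ x :: inv_letter x :: f), b.
  split; rewrite -?catA //=; apply: cancels_pair; by rewrite catA.
- right; exists a, b; split=> //; rewrite -catA; apply: cancels_pair.
  by rewrite catA.
Qed.

Lemma cancels_rot1 x u : cancels (x :: u) -> cancels (u ++ [:: x]).
Proof.
case/(@cancels_partner [::])=> [] [a [b []]]; first by case: a.
move=> -> cb ca; rewrite -catA; apply: (@cancels_insert [::]) => //=.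
rewrite -cat1s; apply: (@cancels_insert [:: inv_letter x]) => //.
by have := @cancels_pair [::] [::] (inv_letter x) cancels_nil; rewrite inv_letterK.
Qed.

Lemma cancels_catC u v : cancels (u ++ v) -> cancels (v ++ u).
Proof.
elim: u v => [|x u IH] v; rewrite ?cats0 //= => /cancels_rot1.
by rewrite -catA => /IH; rewrite -catA.
Qed.

(** The choice of the pair to delete does not matter. If x was cancelled with another x^-1, that
    letter can play the role of the deleted one; when it lies on the right, this uses invariance
    under rotation. *)
Lemma cancels_pair_inv u v x :
  cancels (u ++ x :: inv_letter x :: v) -> cancels (u ++ v).
Proof.
case/cancels_partner=> [] [a [b []]].
  move=> -> cb ca; rewrite -catA cat_cons -cat_rcons.
  by apply: cancels_insert; rewrite ?cat_rcons.
case: b => [|y b] /= []; first by move=> ->.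
move=> <- -> cb cua; rewrite -cat_rcons; apply: cancels_insert => //.
by rewrite -cats1; apply: cancels_rot1.
Qed.

Lemma cancels_remove u v w :
  cancels v -> cancels (u ++ v ++ w) -> cancels (u ++ w).
Proof.
move=> cv; elim: cv u w => [|v1 v2 x _ IH] u w //.
rewrite -catA catA => /cancels_pair_inv; rewrite -catA => c.
by apply: IH; rewrite -catA.
Qed.

Lemma cancels_inv u : cancels u -> cancels (inv_word u).
Proof.
elim=> [|p q x _ IH]; first exact: cancels_nil.
rewrite inv_word_cat !inv_word_cons -!catA /= inv_letterK.
move: IH; rewrite inv_word_cat => IH.
exact: cancels_pair.
Qed.

Lemma cancels_mulV u : cancels (u ++ inv_word u).
Proof.
elim: u => [|x u IH]; first exact: cancels_nil.
rewrite inv_word_cons /= catA -cat1s; apply: cancels_insert => //.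
exact: (@cancels_pair [::] [::] x cancels_nil).
Qed.

Lemma cancels_wrap x u : cancels u -> cancels (x :: u ++ [:: inv_letter x]).
Proof.
move=> cu; apply: (@cancels_insert [:: x]) => //.
exact: (@cancels_pair [::] [::] x cancels_nil).
Qed.

(** Follow the first letter z of b. If its partner lies outside b, this is the pair sought. If it
    lies inside, the prefix of b ending there cancels, and the search goes on in the rest of b, the
    prefix being put back into r afterwards. *)
Lemma cancels_pairing a b c : cancels (a ++ b ++ c) ->
  [\/ cancels b,
      exists z p q r s, [/\ a = p ++ inv_letter z :: q, b = r ++ z :: s,
                            cancels (q ++ r) & cancels (p ++ s ++ c)] |
      exists z p q r s, [/\ c = q ++ inv_letter z :: p, b = r ++ z :: s,
                            cancels (s ++ q) & cancels (a ++ r ++ p)]].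
Proof.
have [k] := ubnP (size b); elim: k b => // k IH [|z b] /= szb.
  by move=> _; constructor 1; exact: cancels_nil.
case/cancels_partner=> [] [p [q []]].
  move=> -> cq cp; constructor 2; exists z, p, q, [::], b.
  by rewrite cats0.
move=> E; have [[e]|[e]] := cat_eq_cat_cons E; last first.
  move=> Eq -> cq cp; constructor 3; exists z, p, e, [::], b.
  by split; rewrite //= -Eq.
move=> Eb Ep cq; rewrite Ep.
have cK := cancels_wrap z cq; set K := _ :: _ in cK.
have EK t : z :: q ++ inv_letter z :: t = K ++ t by rewrite /K /= -catA.
move: szb; rewrite Eb EK => szb /IH[|ce|[y [p' [q' [r [s [-> -> c1 c2]]]]]]
     |[y [p' [q' [r [s [-> -> c1 c2]]]]]]].
- by rewrite size_cat /= in szb; lia.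
- by constructor 1; exact: (@cancels_insert [::] K e).
- constructor 2; exists y, p', q', (K ++ r), s; split; rewrite -?catA //.
  exact: cancels_insert.
- constructor 3; exists y, p', q', (K ++ r), s; split; rewrite -?catA //.
  exact: cancels_insert.
Qed.

(** * Replacing letters along relators *)

Section Relators.
Variable R : word m -> Prop.

(** The symmetrised set of relators; unfolded, it is the condition that [lab_cell] puts on the
    boundary of a cell. *)
Definition relator (u : word m) : Prop :=
  exists2 r, R r & cyclic_eq r u \/ cyclic_eq (inv_word r) u.

Lemma cyclic_eq_rot k u v : cyclic_eq u v -> cyclic_eq u (rot k v).
Proof.
case=> i ->; case: (leqP i (size u)) => [le_i|/ltnW gt_i]; last first.
  by rewrite (rot_oversize gt_i); exists k.
case: (leqP k (size u)) => [le_k|/ltnW gt_k]; last first.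
  by rewrite [rot k _]rot_oversize ?size_rot //; exists i.
by rewrite rot_add_mod //; eexists.
Qed.

Lemma relator_rot k u : relator u -> relator (rot k u).
Proof. by case=> r Rr []H; exists r => //; [left|right]; apply: cyclic_eq_rot. Qed.

Lemma relator_catC u v : relator (u ++ v) -> relator (v ++ u).
Proof. by move=> /(relator_rot (size u)); rewrite rot_size_cat. Qed.

Lemma cyclic_eq_inv u v : cyclic_eq u v -> cyclic_eq (inv_word u) (inv_word v).
Proof.
case=> k ->; exists (size u - k); rewrite /inv_word map_rot rev_rot.
by rewrite /rotr size_rev size_map.
Qed.

Lemma relator_inv u : relator u -> relator (inv_word u).
Proof.
case=> r Rr [] /cyclic_eq_inv ?; exists r => //; first by right.
by left; rewrite -(inv_wordK r).
Qed.

(* Each letter x of the first word is either kept or replaced by a word c such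
   that x^-1 c is a relator, the letters of c being treated in the same way. *)
Inductive expands : word m -> word m -> Prop :=
| expands_nil : expands [::] [::]
| expands_keep x w t : expands w t -> expands (x :: w) (x :: t)
| expands_relator x c s w t :
    relator (inv_letter x :: c) -> expands c s -> expands w t ->
    expands (x :: w) (s ++ t).

Lemma expands_refl w : expands w w.
Proof. by elim: w => [|x w IH]; [exact: expands_nil|exact: expands_keep]. Qed.

Lemma expands_cat u v s t :
  expands u s -> expands v t -> expands (u ++ v) (s ++ t).
Proof.
move=> eu ev; elim: eu => //= [x u1 s1 _ IH|x c s1 u1 s2 rc ec _ eu IH].
  exact: expands_keep.
by rewrite -catA; apply: expands_relator ec _.
Qed.

Lemma expands_split u v t : expands (u ++ v) t ->
  exists s1 s2, [/\ t = s1 ++ s2, expands u s1 & expands v s2].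
Proof.
move Ew: (u ++ v) => w ew.
elim: ew u Ew => [|x w' s ew IH|x c s w' s' rc ec _ ew IH] [|y u] //=.
- by move=> ->; exists [::], [::]; split=> //; exact: expands_nil.
- move=> ->; exists [::], (x :: s); split=> //; first exact: expands_nil.
  exact: expands_keep.
- case=> -> /IH[s1 [s2 [-> e1 e2]]]; exists (x :: s1), s2; split=> //.
  exact: expands_keep.
- move=> ->; exists [::], (s ++ s'); split=> //; first exact: expands_nil.
  exact: expands_relator ec ew.
- case=> -> /IH[s1 [s2 [-> e1 e2]]]; exists (s ++ s1), s2.
  by rewrite catA; split=> //; exact: expands_relator ec e1.
Qed.

Lemma expands_trans s w t : expands w s -> expands s t -> expands w t.
Proof.
move=> ew; elim: ew t => {w s} [|x w s _ IH|x c s w s' rc _ IHc _ IHw] t //.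
- rewrite -[x :: s]cat1s => /expands_split[s1 [s2 [-> e1 /IH e2]]].
  by rewrite -[x :: w]cat1s; exact: expands_cat.
- case/expands_split=> s1 [s2 [-> /IHc e1 /IHw e2]].
  exact: expands_relator e1 e2.
Qed.

Lemma expands_inv u t : expands u t -> expands (inv_word u) (inv_word t).
Proof.
elim=> [|x w s _ IH|x c s w t' rc ec IHc _ IHw]; first exact: expands_nil.
  rewrite !inv_word_cons; apply: expands_cat => //; exact: expands_refl.
rewrite inv_word_cons inv_word_cat; apply: expands_cat => //.
rewrite -[inv_word s]cats0.
apply: expands_relator IHc expands_nil; rewrite inv_letterK.
by have := relator_inv rc; rewrite inv_word_cons inv_letterK => /relator_catC.
Qed.

(* The relators used between the letters of w and z can be applied backwards. *)
Lemma expands_reverse w t : expands w t ->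
  forall p q s1 s2 r z s, relator (p ++ w ++ q) -> expands p s1 -> expands q s2 ->
  t = r ++ z :: s -> expands [:: inv_letter z] (s ++ s2 ++ s1 ++ r).
Proof.
elim=> [|x u t' eu IH|x c t1 u t2 rc ec IHc eu IHu] p q s1 s2 r z s rel ep eq.
- by case: r.
- case: r => [|y r] /= [].
    move=> <- <-; rewrite cats0 -[_ ++ _]cats0.
    apply: (@expands_relator _ (u ++ q ++ p)); last exact: expands_nil.
      by have := relator_catC rel; rewrite inv_letterK /= -catA.
    by do ! apply: expands_cat.
  move=> <- Et; rewrite -cat_rcons; apply: (IH (rcons p x) q) Et => //.
    by rewrite cat_rcons -cat_cons.
  by rewrite -!cats1; apply: expands_cat (expands_refl _).
- move=> E; have [[e]|[e]] := cat_eq_cat_cons E; last first.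
    move=> -> Et2; rewrite [s1 ++ _]catA; apply: (IHu (p ++ [:: x]) q) Et2 => //.
      by rewrite -catA.
    apply: expands_cat => //; rewrite -[t1]cats0.
    by apply: expands_relator ec expands_nil.
  move=> Et1 ->; rewrite -!catA.
  (* Here z comes from the word c put in place of x. The letter x^-1 expands around the outer
     relator into u q p, so the induction applies to the inner relator x^-1 c, with x^-1 as its left
     context. *)
  have := IHc [:: inv_letter x] [::] (t2 ++ s2 ++ s1) [::] r z e.
  rewrite cats0 /= -!catA; apply=> //; last exact: expands_nil.
  rewrite -[_ ++ _]cats0.
  apply: (@expands_relator _ (u ++ q ++ p)); last exact: expands_nil.
    by have := relator_catC rel; rewrite inv_letterK /= -catA.
  by do ! apply: expands_cat.
Qed.

(** The normal form of a reduction: cell moves only, then leaf moves only. *)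
Definition trivializes w := exists2 t, expands w t & cancels t.

(* When a letter z coming from c cancels some z^-1 coming from u or v, this z^-1
   can instead be expanded all the way around the relator c, which makes up for
   the deletion of c. *)
Lemma trivializes_del_relator u c v :
  relator c -> trivializes (u ++ c ++ v) -> trivializes (u ++ v).
Proof.
move=> rc [t] /expands_split[tu [t' [-> eu /expands_split[tc [tv [-> ec ev]]]]]].
have rev r z s : tc = r ++ z :: s -> expands [:: inv_letter z] (s ++ r).
  have rc0 : relator ([::] ++ c ++ [::]) by rewrite cats0.
  exact: (expands_reverse ec rc0 expands_nil expands_nil).
have subst w p y q a : expands w (p ++ y :: q) -> expands [:: y] a ->
    expands w (p ++ a ++ q).
  move=> ew ey; apply: expands_trans ew _; rewrite -[y :: q]cat1s.
  by do ! apply: expands_cat => //; exact: expands_refl.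
move=> ct; case: (cancels_pairing ct) => [cc|[z [p [q [r [s [Etu Etc cqr cpsv]]]]]]
                          |[z [p [q [r [s [Etv Etc csq curp]]]]]]].
- exists (tu ++ tv); first exact: expands_cat.
  exact: cancels_remove cc _.
- exists ((p ++ (s ++ r) ++ q) ++ tv).
    by apply: expands_cat ev; apply: subst (rev _ _ _ Etc); rewrite -Etu.
  rewrite -!catA [r ++ _]catA [p ++ _]catA; apply: cancels_insert.
    exact: cancels_catC.
  by rewrite -catA.
- exists (tu ++ q ++ (s ++ r) ++ p).
    by apply: expands_cat eu _; apply: subst (rev _ _ _ Etc); rewrite -Etv.
  rewrite -!catA [q ++ _]catA; apply: cancels_insert => //.
  exact: cancels_catC.
Qed.

(** If both letters are kept, the pair is deleted from the expanded word. If x is replaced by c,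
    then c x^-1 is a rotation of the relator x^-1 c and is deleted as a whole; likewise x c if x^-1
    is replaced by c. *)
Lemma trivializes_cancel u v x :
  trivializes (u ++ x :: inv_letter x :: v) -> trivializes (u ++ v).
Proof.
case=> t /expands_split[tu [t' [-> eu]]].
rewrite -[x :: _]cat1s => /expands_split[tx [t'' [-> ex]]].
rewrite -[_ :: v]cat1s => /expands_split[ty [tv [-> ey ev]]] ct.
have keep_or_relator a ta : expands [:: a] ta -> ta = [:: a] \/
    exists2 c, relator (inv_letter a :: c) & expands c ta.
  move Ea: [:: a] => w ea; case: ea Ea => //.
    by move=> b w1 t1 e1 [-> Ew]; move: e1; rewrite -Ew => e1; inversion e1; left.
  move=> b c s w1 t1 rc ec e1 [-> Ew]; right; exists c => //.
  by move: e1; rewrite -Ew => e1; inversion e1; rewrite cats0.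
case: (keep_or_relator _ _ ex) => [Ex|[c rc ec]]; last first.
  apply: (@trivializes_del_relator u (c ++ [:: inv_letter x]) v).
    by apply: relator_catC.
  exists (tu ++ tx ++ ty ++ tv) => //.
  by apply: expands_cat eu _; rewrite -catA; do ! apply: expands_cat => //.
case: (keep_or_relator _ _ ey) => [Ey|[c rc ec]]; last first.
  apply: (@trivializes_del_relator u (x :: c) v).
    by rewrite -[x]inv_letterK.
  exists (tu ++ tx ++ ty ++ tv) => //.
  apply: expands_cat eu _; rewrite -cat1s -catA.
  by do ! apply: expands_cat => //.
exists (tu ++ tv); first exact: expands_cat.
by move: ct; rewrite Ex Ey; exact: cancels_pair_inv.
Qed.

Lemma trivializes_free_eq u v : free_eq u v -> trivializes u <-> trivializes v.
Proof.
elim=> // {u v} [u v x|u v _ [IH1 IH2]|u v w _ [IH1 IH2] _ [IH3 IH4]].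
- split=> [|[t]]; first exact: trivializes_cancel.
  move=> /expands_split[tu [tv [-> eu ev]]] c.
  exists (tu ++ [:: x; inv_letter x] ++ tv); last exact: cancels_pair.
  by do ! apply: expands_cat => //; exact: expands_refl.
- by split.
- by split; auto.
Qed.

Lemma relator_trivializes r : R r -> trivializes r.
Proof.
case: r => [|x r] Rr; first by exists [::]; [exact: expands_nil|exact: cancels_nil].
(* In a relator x r the letter x may be replaced by r^-1, because x^-1 r^-1 is a rotation of the
   inverse relator. *)
exists (inv_word r ++ r); last by rewrite -{2}[r]inv_wordK; exact: cancels_mulV.
apply: (@expands_relator _ (inv_word r)); try exact: expands_refl.
apply: (@relator_catC (inv_word r) [:: _]); rewrite -inv_word_cons.
by apply: relator_inv; exists (x :: r) => //; left; exists 0; rewrite rot0.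
Qed.

Lemma normal_closure_trivializes w : normal_closure R w -> trivializes w.
Proof.
elim=> {w} [r|||u _ [t et ct]|u v _ [t et ct]|u v uv _].
- exact: relator_trivializes.
- by exists [::]; [exact: expands_nil|exact: cancels_nil].
- move=> u v _ [s es cs] _ [t et ct]; exists (s ++ t); first exact: expands_cat.
  by rewrite -[t]cats0; apply: cancels_insert; rewrite ?cats0.
- by exists (inv_word t); [exact: expands_inv|exact: cancels_inv].
- exists (v ++ t ++ inv_word v).
    by do ! apply: expands_cat => //; exact: expands_refl.
  by apply: cancels_insert => //; exact: cancels_mulV.
- by case: (trivializes_free_eq uv).
Qed.

(* The word w bounds a diagram with n edges: each step removes an edge lying on
   the boundary, either between the outside and a cell or leading to a leaf. *)
Inductive reduces : nat -> word m -> Prop :=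
| reduces_nil : reduces 0 [::]
| reduces_leaf n u v x :
    reduces n (u ++ v) -> reduces n.+1 (u ++ x :: inv_letter x :: v)
| reduces_cell n u c v x :
    relator (inv_letter x :: c) -> reduces n (u ++ c ++ v) ->
    reduces n.+1 (u ++ x :: v).

Lemma normal_closure_reduces w : normal_closure R w -> exists n, reduces n w.
Proof.
case/normal_closure_trivializes=> t ew ct.
have [n rt] : exists n, reduces n t.
  elim: ct => [|u v x _ [n]]; first by exists 0; exact: reduces_nil.
  by exists n.+1; exact: reduces_leaf.
(* The expansion is undone letter by letter, inside an arbitrary context because the moves act on
   factors. *)
suff: forall u v n, reduces n (u ++ t ++ v) -> exists k, reduces k (u ++ w ++ v).
  by move=> /(_ [::] [::] n); rewrite /= !cats0; apply.
elim: ew => {w t ct n rt} [|x w s _ IH|x c s w t rc ec IHc ew IHw] u v n.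
- by exists n.
- by rewrite -cat_rcons => /IH[k]; rewrite cat_rcons; exists k.
- rewrite -catA => /IHc[k]; rewrite !catA -[_ ++ v]catA => /IHw[l].
  by rewrite -!catA => /(reduces_cell rc) rl; exists l.+1.
Qed.

Lemma free_eq_mulV u v w : free_eq (u ++ v ++ inv_word v ++ w) (u ++ w).
Proof.
elim: v u w => [|x v IH] u w; first exact: free_refl.
rewrite inv_word_cons -catA cat_cons -cat_rcons.
apply: (free_trans (IH (rcons u x) (inv_letter x :: w))).
by rewrite cat_rcons; exact: free_cancel.
Qed.

Lemma normal_closure_catC u v :
  normal_closure R (u ++ v) -> normal_closure R (v ++ u).
Proof.
move=> /nc_conj -/(_ v); apply: nc_free.
by have := free_eq_mulV (v ++ u) v [::]; rewrite !cats0 -!catA.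
Qed.

Lemma normal_closure_relator u : relator u -> normal_closure R u.
Proof.
have rot_nc k w : normal_closure R w -> normal_closure R (rot k w).
  by rewrite -{1}(cat_take_drop k w); exact: normal_closure_catC.
by case=> r /nc_relator nr [] [k ->]; apply: rot_nc => //; exact: nc_inv.
Qed.

Lemma reduces_normal_closure n w : reduces n w -> normal_closure R w.
Proof.
elim=> {n w} [|n u v x _|n u c v x rc _]; first exact: nc_one.
  by apply: nc_free; apply: free_sym; exact: free_cancel.
(* With u rotated to the end, x v u is freely equal to the product of x c^-1, a rotated inverse
   relator, and c v u. *)
move=> /(@normal_closure_catC u (c ++ v)); rewrite -catA => nc_cvu.
rewrite -[x :: v]cat1s; apply: normal_closure_catC.
have := nc_inv (normal_closure_relator rc).
rewrite inv_word_cons inv_letterK => /normal_closure_catC nx.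
apply: nc_free (nc_mul nx nc_cvu); rewrite -{2}[c]inv_wordK.
exact: (@free_eq_mulV [:: x] (inv_word c) (v ++ u)).
Qed.

End Relators.

End Words.

(** * From diagrams to reductions *)

Lemma sum_count_mem (T : finType) (s : seq T) : \sum_x count_mem x s = size s.
Proof.
elim: s => [|a s IH] /=; first by rewrite big1.
rewrite big_split /= IH (bigD1 a) //= eqxx big1 // => x.
by rewrite eq_sym => /negPf->.
Qed.

(** Otherwise every entry other than x would occur at least twice, and twice the number of distinct
    entries would be at most [size s + 1]. This yields a leaf of a tree away from the base point
    x. *)
Lemma exists_count1 (T : finType) (s : seq T) x :
  (size s).+2 <= (size (undup s)).*2 -> exists2 y, y != x & count_mem y s = 1.
Proof.
move=> lt_s; case: (pickP (fun y => (y != x) && (count_mem y s == 1))) => [y|no].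
  by case/andP=> yx /eqP; exists y.
suff: (size (undup s)).*2 <= size s + 1 by lia.
rewrite -!sum_count_mem -mul2n big_distrr /=.
have E1 : \sum_y (y == x : nat) = 1.
  by rewrite (bigD1 x) //= eqxx big1 // => y /negPf->.
rewrite -[X in _ + X]E1 -big_split; apply: leq_sum => y _ /=.
rewrite count_uniq_mem ?undup_uniq // mem_undup -has_pred1 has_count.
by move: (no y); case: (y == x); case: (count_mem y s) => [|[|k]] //=; lia.
Qed.

Lemma count_mem_map1_inj (T U : eqType) (f : T -> U) (s : seq T) y a b :
  count_mem y (map f s) = 1 -> a \in s -> b \in s -> f a = y -> f b = y -> a = b.
Proof.
rewrite count_map -size_filter => E a_s b_s fa fb.
have mem_F c : c \in s -> f c = y -> c \in filter (preim f (pred1 y)) s.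
  by move=> c_s fc; rewrite mem_filter /= fc eqxx.
move: (mem_F a a_s fa) (mem_F b b_s fb).
by case: filter E => [|c []] //= _; rewrite !inE => /eqP-> /eqP->.
Qed.

Section EdgePathTheory.
Variables (V T : finType) (origin : T -> V) (opp : T -> T).
Local Notation epath := (epath origin opp).

Lemma epath_cat x p q y :
  epath x (p ++ q) y <-> exists2 z, epath x p z & epath z q y.
Proof.
elim: p x => [|d p IH] x /=.
  by split=> [eq|[z /eqP->]//]; exists x.
split=> [/andP[od /IH[z ep eq]]|[z /andP[od ep] eq]].
  by exists z => //; rewrite od.
by rewrite od; apply/IH; exists z.
Qed.

Lemma mem_origin_closed x z p q :
  epath x p z -> epath z q x -> p ++ q != [::] -> z \in map origin (p ++ q).
Proof.
case: q => [|d q]; last first.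
  by move=> _ /andP[/eqP<- _] _; rewrite map_cat mem_cat inE eqxx orbT.
rewrite cats0 => + /eqP zx; rewrite zx; case: p => //= d p /andP[/eqP<- _] _.
by rewrite inE eqxx.
Qed.

End EdgePathTheory.

(** * Taking a diagram apart edge by edge *)

Section Reduction.
Variables (m : nat) (R : word m -> Prop).
Variables (V T : finType) (origin : T -> V) (opp : T -> T) (lab : T -> letter m).
Hypothesis oppK : involutive opp.
Hypothesis lab_opp : forall d, lab (opp d) = inv_letter (lab d).
Local Notation epath := (epath origin opp).

(* A closed path that runs through each of its edges once in each direction, and
   has one edge less than it has vertices, goes around a tree: by counting, some
   vertex other than the base point is visited only once. *)
Lemma tree_reduces x p : epath x p x -> uniq p -> {in p, forall d, opp d \in p} ->
  p = [::] \/ (size p).+2 <= (size (undup (map origin p))).*2 ->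
  reduces R (size p)./2 (map lab p).
Proof.
have [k] := ubnP (size p); elim: k p => // k IH p szp ep up op.
case=> [->|]; first exact: reduces_nil.
rewrite -{1}(size_map origin p) => le_p; have [v vx cv] := exists_count1 x le_p.
have /mapP[e e_p ve] : v \in map origin p by rewrite -has_pred1 has_count cv.
case/splitPr: p / e_p szp ep up op cv le_p => q r szp /epath_cat[z eq0 /=].
rewrite ve => /andP[/eqP zv er] up op cv le_p.
case/lastP: q => [|q d] in szp eq0 up op cv le_p *.
  by case/negP: vx; rewrite ve zv eq_sym.
rewrite -cats1 -!catA /= in szp eq0 up op cv le_p *.
case/epath_cat: eq0 => y eq0 /= /andP[/eqP dy /eqP oz].
(* Only one dart of p issues from v, so the path must leave v by the edge d along which it
   arrived. *)
have Ee : e = opp d.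
  apply: (count_mem_map1_inj cv); rewrite ?oz //.
    by rewrite mem_cat !inE eqxx !orbT.
  by apply: op; rewrite mem_cat inE eqxx orbT.
subst e; rewrite oppK dy in er.
have ep' : epath x (q ++ r) x by apply/epath_cat; exists y.
have perm_p : perm_eq (q ++ d :: opp d :: r) [:: d, opp d & q ++ r].
  by rewrite -[d :: _]/([:: d; opp d] ++ r) perm_catCA.
have mem_p f : (f \in q ++ d :: opp d :: r) = [|| f == d, f == opp d | f \in q ++ r].
  by rewrite (perm_mem perm_p) !inE.
have /= /and3P[d_p od_p up'] : uniq [:: d, opp d & q ++ r] by rewrite -(perm_uniq perm_p).
have op' : {in q ++ r, forall f, opp f \in q ++ r}.
  move=> f f_p; have := op f; rewrite !mem_p f_p !orbT => /(_ isT).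
  case/or3P=> // /eqP E; last first.
    by rewrite -(inv_inj oppK E) inE f_p orbT in d_p.
  by rewrite -E oppK f_p in od_p.
have sz_p : size (q ++ d :: opp d :: r) = (size (q ++ r)).+2 by rewrite (perm_size perm_p).
rewrite sz_p map_cat /= lab_opp; apply: reduces_leaf; rewrite -map_cat.
have szp' : size (q ++ r) < k by move: szp; rewrite sz_p ltnS; exact: ltnW.
apply: IH => //.
case: (altP (q ++ r =P [::])) => [->|p'0]; [by left|right].
(* Two darts go and at most the vertex v is lost, so the counting bound is preserved. *)
suff : size (undup (map origin (q ++ d :: opp d :: r))) <=
    (size (undup (map origin (q ++ r)))).+1.
  by rewrite -leq_double doubleS; move: le_p; rewrite size_map sz_p; exact: leq_trans.
apply: (uniq_leq_size (s2 := v :: _)); first exact: undup_uniq.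
move=> w; rewrite mem_undup inE mem_undup => /mapP[f]; rewrite mem_p.
case/or3P=> [/eqP->|/eqP->|f_p] -> //; last by rewrite map_f ?orbT.
  by rewrite dy (mem_origin_closed eq0 er) // orbT.
by rewrite -ve eqxx.
Qed.

Section Disc.
Variables (face : T -> T) (d0 : T).
Hypothesis dual_connected : forall (S : {pred T}), {in S, forall d, face d \in S} ->
  {in S, forall d, opp d \in S} -> forall d e, d \in S -> e \in S.

(** Invariant of the dismantling: each remaining dart occurs once, on the outer closed path p or
    around a cell of cs. The last hypothesis is Euler's inequality, edges + 1 <= vertices + cells.
    It survives the removal of an edge together with a cell, and without cells it becomes the
    counting hypothesis of [tree_reduces]. The dart d0 of the original outer region witnesses that
    the cells never contain all darts. *)
Lemma disc_reduces x p (cs : seq (seq T)) :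
    epath x p x ->
    {in cs, forall c, c != [::] /\ exists y, epath y c y} ->
    {in cs, forall c, relator R (map lab c)} ->
    {in cs, forall c, {in c, forall d, face d \in c}} ->
    d0 \notin flatten cs ->
    uniq (p ++ flatten cs) -> {in p ++ flatten cs, forall d, opp d \in p ++ flatten cs} ->
    (p != [::] -> forall v, v \in map origin (p ++ flatten cs)) ->
    (size (p ++ flatten cs)).+2 <= (#|V| + size cs).*2 ->
  reduces R (size (p ++ flatten cs))./2 (map lab p).
Proof.
have [k] := ubnP (size cs); elim: k x p cs => // k IH x p cs szcs.
move=> ep closed_cs rel_cs face_cs d0_cs u_s op_s org_s euler.
case: (hasP (a := fun d => opp d \in flatten cs) (s := p)) => [[d d_p od_cs]|no].
  have [c c_cs od_c] := flattenP od_cs.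
  have perm_cs := perm_to_rem c_cs; set cs' := rem c cs in perm_cs.
  have sub_cs c' : c' \in cs' -> c' \in cs by exact: mem_rem.
  case/splitPr: d_p ep u_s op_s org_s euler => u v /epath_cat[y eu /= /andP[/eqP dy ev]] u_s op_s org_s euler.
  have [c0 [z ec]] := closed_cs _ c_cs; have rc := rel_cs _ c_cs.
  have [c1 [c2 Ec]] : exists c1 c2, c = c1 ++ opp d :: c2.
    by case/splitPr: od_c => c1 c2; exists c1, c2.
  rewrite Ec in ec rc perm_cs.
  case/epath_cat: ec => y' ec1 /= /andP[/eqP oy']; rewrite oppK dy => ec2.
  rewrite -oy' in ec1.
  (* The dart d is replaced by the rest of the boundary of its cell, read from just after
     [opp d]. *)
  set p' := u ++ c2 ++ c1 ++ v.
  have ep' : epath x p' x.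
    by do ! (apply/epath_cat; eexists; first by eassumption).
  have perm_s : perm_eq ((u ++ d :: v) ++ flatten cs) [:: d, opp d & p' ++ flatten cs'].
    rewrite (perm_catl _ (perm_flatten perm_cs)) /=.
    apply/permP => f; rewrite /p' ?count_cat /= ?count_cat /=.
    move: (f d : nat) (f (opp d) : nat) (count f u) (count f v) (count f c1).
    by move: (count f c2) (count f _); clear=> *; lia.
  have mem_s f : (f \in (u ++ d :: v) ++ flatten cs)
      = [|| f == d, f == opp d | f \in p' ++ flatten cs'].
    by rewrite (perm_mem perm_s) !inE.
  have /= /and3P[d_s od_s' u_s'] : uniq [:: d, opp d & p' ++ flatten cs'].
    by rewrite -(perm_uniq perm_s).
  have op_s' : {in p' ++ flatten cs', forall f, opp f \in p' ++ flatten cs'}.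
    move=> f f_s; have := op_s f; rewrite !mem_s f_s !orbT => /(_ isT).
    case/or3P=> // /eqP E; last first.
      by rewrite -(inv_inj oppK E) inE f_s orbT in d_s.
    by rewrite -E oppK f_s in od_s'.
  have sz_s := perm_size perm_s; rewrite /= in sz_s.
  have sz_cs : size cs = (size cs').+1 by rewrite (perm_size perm_cs).
  rewrite sz_s map_cat /=; apply: (@reduces_cell _ _ _ _ (map lab (c2 ++ c1))).
    rewrite -lab_opp -[_ :: _]/(map lab ((opp d :: c2) ++ c1)) map_cat.
    by apply: relator_catC; rewrite -map_cat.
  have -> : map lab u ++ map lab (c2 ++ c1) ++ map lab v = map lab p'.
    by rewrite /p' !map_cat -!catA.
  apply: (IH x) => //.
  - by rewrite sz_cs in szcs.
  - by move=> c' /sub_cs; exact: closed_cs.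
  - by move=> c' /sub_cs; exact: rel_cs.
  - by move=> c' /sub_cs; exact: face_cs.
  - apply: contra d0_cs => /flattenP[c' /sub_cs c'_cs d0_c'].
    by apply/flattenP; exists c'.
  - move=> p'0 w; have p0 : u ++ d :: v != [::] by case: (u).
    have /mapP[f] := org_s p0 w; rewrite mem_s => /or3P[/eqP->|/eqP->|f_s] ->; last exact: map_f.
      rewrite map_cat mem_cat; apply/orP; left; rewrite dy.
      apply: mem_origin_closed eu _ p'0.
      by do ! (apply/epath_cat; eexists; first by eassumption).
    rewrite map_cat mem_cat; apply/orP; left; rewrite /p' 2!catA.
    apply: mem_origin_closed _ ev _; last by rewrite -!catA.
    by do ! (apply/epath_cat; eexists; first by eassumption).
  - by move: euler; rewrite sz_s sz_cs addnS doubleS !ltnS.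
(* No edge of p borders a cell any more, so the darts of the cells are closed under [face] and
   [opp]; if there were any, d0 would be among them. *)
have Ecs : cs = [::].
  case Ecs : {+}cs => [//|c cs']; case/negP: d0_cs.
  have [] := closed_cs c; first by rewrite Ecs inE eqxx.
  case Ec : c => [//|d c'] _ _; apply: (@dual_connected (mem (flatten cs)) _ _ d).
  - by move=> e /flattenP[c1 c1_cs e_c1]; apply/flattenP; exists c1; rewrite ?(face_cs c1).
  - move=> e e_cs; have := op_s e; rewrite !mem_cat e_cs orbT => /(_ isT).
    case/orP=> // oe_p; case: no; exists (opp e) => //; by rewrite oppK.
  - by rewrite Ecs Ec /= inE eqxx.
rewrite Ecs cats0 /= in u_s op_s org_s euler *; apply: tree_reduces ep _ _ _ => //.
case: (altP (p =P [::])) => [->|p0]; [by left|right].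
apply: leq_trans euler _; rewrite addn0 leq_double cardE.
by apply: uniq_leq_size (enum_uniq _) _ => v _; rewrite mem_undup org_s.
Qed.
End Disc.
End Reduction.

Lemma odd_count_addb (T : eqType) (a b : pred T) s :
  odd (count (fun x => a x (+) b x) s) = odd (count a s) (+) odd (count b s).
Proof. by elim: s => //= x s IH; rewrite !oddD IH; case: (a x) (b x) => [] [] /=; case: odd; case: odd. Qed.

Lemma uniq_flatten_orbits (T : finType) (f : T -> T) (s : seq T) :
  injective f -> uniq s -> {subset s <= froots f} -> uniq (flatten (map (orbit f) s)).
Proof.
move=> injf; elim: s => //= r s IH /andP[r_s us] roots_s.
rewrite cat_uniq orbit_uniq IH //=; last by move=> x x_s; rewrite roots_s ?inE ?x_s ?orbT.
rewrite andbT; apply/hasPn => x /flatten_mapP[r' r'_s]; rewrite -!fconnect_orbit => r'x.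
apply/negP => rx; case/negP: r_s.
have -> // : r = r'.
rewrite -(eqP (roots_s r _)) ?mem_head // -(eqP (roots_s r' _)) ?inE ?r'_s ?orbT //.
apply/(rootP (fconnect_sym injf)); apply: connect_trans rx _.
by rewrite fconnect_sym.
Qed.

(** * Global properties of a diagram *)

Section Diagram.
Variables (m : nat) (R : word m -> Prop) (D : diagram R).
Local Notation origin := (@origin _ _ D).
Local Notation opp := (@opp _ _ D).
Local Notation face := (@face _ _ D).
Local Notation cell := (@cell _ _ D).
Local Notation lab := (@lab _ _ D).
Local Notation epath := (epath origin opp).
Implicit Types d e : dart D.

Let face_inj := @face_injective _ _ D.
Let oppK := @opp_involutive _ _ D.

Lemma origin_face d : origin (face d) = origin (opp d).
Proof.
apply/esym/origin_rotation; have := fconnect1 (face \o opp) (opp d).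
by rewrite /= oppK.
Qed.

Lemma epath_orbit d : epath (origin d) (orbit face d) (origin d).
Proof.
suff walk n e : epath (origin e) (traject face e n) (origin (iter n face e)).
  by have := walk (fingraph.order face d) d; rewrite iter_order.
elim: n e => [|n IH] e; first exact: eqxx.
by rewrite iterSr /= eqxx -origin_face; exact: IH.
Qed.

(** Turning around a vertex is [face \o opp], so S contains all darts of a vertex or none, and it
    passes along edges through [opp]; the 1-skeleton is connected. S is in [Prop] so that it may be
    an existence statement. *)
Lemma dual_connected (S : dart D -> Prop) :
  (forall d, S d -> S (face d)) -> (forall d, S d -> S (opp d)) ->
  forall d e, S d -> S e.
Proof.
move=> Sface Sopp.
have Sorigin d e : origin d = origin e -> S d -> S e.
  move=> /origin_rotation/iter_findex<- Sd.
  by elim: (findex _ _ _) => //= n Sn; apply/Sface/Sopp.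
move=> d e; have [p] := diagram_connected (origin d) (origin e).
elim: p d => [|f p IH] d /=; first by move=> /eqP; exact: Sorigin.
by case/andP=> /eqP od ep Sd; apply: IH ep _; apply/Sopp/(Sorigin d).
Qed.

Lemma mem_cell_fconnect d e : fconnect face d e -> (e \in cell) = (d \in cell).
Proof.
by move=> /iter_findex<-; elim: (findex _ _ _) => //= n; rewrite cell_face.
Qed.

(** Such a c is a 1-cocycle modulo 2: spurs contribute twice and cell boundaries evenly. *)
Lemma homotopic_odd_count (c : pred (dart D)) x y p q :
    (forall d, c (opp d) = c d) ->
    {in cell, forall d, ~~ odd (count c (orbit face d))} ->
    homotopic origin opp face cell x y p q ->
  odd (count c p) = odd (count c q).
Proof.
move=> c_opp c_cell; elim=> {p q} // [p q d _ _|p q d d_cell _ _|p q r _ -> _ -> //].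
  by rewrite !count_cat /= c_opp addn0 !oddD addbb.
by rewrite !count_cat !oddD (negPf (c_cell d d_cell)).
Qed.

(* If d and e lay on different holes, a curve from one hole to the other would
   cross some loop an odd number of times, and this parity, given by c below, is
   a homotopy invariant. *)
Lemma outer_face_unique d e : d \notin cell -> e \notin cell -> fconnect face d e.
Proof.
move=> d_out e_out; apply: contraT => de.
(* c is the set of edges crossed by a curve from the region of d to that of f: the boundary of a
   region meets it oddly exactly when the region contains one end of the curve and not the other. *)
pose crossing f (c : pred (dart D)) := (forall g, c (opp g) = c g) /\
  forall g, odd (count c (orbit face g)) = fconnect face g d (+) fconnect face g f.
have [c [c_opp c_face]] : exists c, crossing e c.
  apply: (@dual_connected (fun f => exists c, crossing f c) _ _ d).
  - move=> f [c [c_opp c_face]]; exists c; split=> // g.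
    by rewrite c_face -(same_fconnect1_r face_inj).
  - move=> f [c [c_opp c_face]].
    (* The curve is prolonged across the edge of f into the region of [opp f]. *)
    exists (fun g => c g (+) pred2 f (opp f) g); split=> g.
      rewrite c_opp /= (inv_eq oppK) (inj_eq (inv_inj oppK)); congr (_ (+) _).
      by rewrite orbC.
    rewrite odd_count_addb c_face -addbA; congr (_ (+) _).
    have -> : odd (count (pred2 f (opp f)) (orbit face g)) =
        odd (count_mem f (orbit face g) + count_mem (opp f) (orbit face g)).
      rewrite -count_predUI; congr (odd _); rewrite -[LHS]addn0; congr (_ + _).
      rewrite -(count_pred0 (orbit face g)); apply: eq_count => h /=.
      by case: eqP => //= ->; apply/esym/negbTE; rewrite eq_sym opp_neq.
    by rewrite oddD !count_uniq_mem ?orbit_uniq // -!fconnect_orbit !oddb addKb.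
  - by exists pred0; split=> // g; rewrite count_pred0 addbb.
have c_cell : {in cell, forall g, ~~ odd (count c (orbit face g))}.
  move=> g g_cell; rewrite c_face.
  case: (boolP (fconnect face g d)) => [/mem_cell_fconnect E|_].
    by rewrite E g_cell in d_out.
  case: (boolP (fconnect face g e)) => [/mem_cell_fconnect E|//].
  by rewrite E g_cell in e_out.
have := homotopic_odd_count c_opp c_cell (diagram_simply_connected (epath_orbit d)).
by rewrite c_face connect0 (negPf de).
Qed.

Lemma even_darts : #|dart D| = (#|dart D|./2).*2.
Proof.
suff : fcard opp (dart D) * 2 = #|dart D|.
  by move=> <-; rewrite muln2 doubleK.
apply: (fcard_order_set (inv_inj oppK)) => //.
apply/subsetP => d _; rewrite !inE; apply/eqP.
apply: (@order_cycle _ _ [:: d; opp d]); rewrite /= ?oppK ?eqxx ?inE ?eqxx //.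
by rewrite eq_sym opp_neq.
Qed.

Lemma diagram_reduces w : boundary_label D w -> reduces R (ncells D 1) w.
Proof.
case=> p [[D0 ->]|[d d_out ->]] [k ->].
  by rewrite /= D0 /=; exact: reduces_nil.
rewrite -map_rot /ncells; set p' := rot k _.
pose rs := enum [pred r | (r \in froots face) && (r \in cell)].
pose cs := map (orbit face) rs.
have mem_p' e : (e \in p') = fconnect face d e by rewrite mem_rot -fconnect_orbit.
have mem_cs e : (e \in flatten cs) = (e \in cell).
  apply/flatten_mapP/idP => [[r]|e_cell].
    by rewrite mem_enum inE -fconnect_orbit => /andP[_ r_cell] /mem_cell_fconnect->.
  have re : fconnect face (froot face e) e by rewrite fconnect_sym // connect_root.
  exists (froot face e); last by rewrite -fconnect_orbit.
  rewrite mem_enum; apply/andP; split; last by rewrite -(mem_cell_fconnect re).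
  by apply: roots_root; exact: fconnect_sym.
have mem_s e : e \in p' ++ flatten cs.
  rewrite mem_cat mem_p' mem_cs; case: (boolP (e \in cell)) => [|/(outer_face_unique d_out)->//].
  by rewrite orbT.
have uniq_s : uniq (p' ++ flatten cs).
  rewrite cat_uniq rot_uniq orbit_uniq uniq_flatten_orbits ?enum_uniq //=; last first.
    by move=> r; rewrite mem_enum inE => /andP[].
  rewrite andbT; apply/hasPn => e; rewrite mem_cs mem_p' => e_cell.
  by apply/negP => /mem_cell_fconnect E; rewrite -E e_cell in d_out.
have size_s : size (p' ++ flatten cs) = #|dart D|.
  by rewrite -(card_uniqP uniq_s); apply: eq_card => e; rewrite mem_s.
have [x ep'] : exists x, epath x p' x.
  have := epath_orbit d; rewrite -{1}(cat_take_drop k (orbit face d)).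
  by case/epath_cat=> z e1 e2; exists z; apply/epath_cat; exists (origin d).
rewrite -size_s; have dual (S : {pred dart D}) : {in S, forall d, face d \in S} ->
    {in S, forall d, opp d \in S} -> forall d e, d \in S -> e \in S.
  by move=> Sf So f e; apply: (@dual_connected (fun d => d \in S)).
apply: (disc_reduces oppK (@lab_opp _ _ D) (d0 := d) dual ep') => //.
- move=> c /mapP[r _ ->]; split; last by exists (origin r); exact: epath_orbit.
  by rewrite -size_eq0 size_orbit -lt0n order_gt0.
- move=> c /mapP[r]; rewrite mem_enum inE => /andP[_ /lab_cell H] ->.
  exact: H.
- move=> c /mapP[r _ ->] e; rewrite -!fconnect_orbit => re.
  exact: connect_trans re (fconnect1 _ _).
- by rewrite mem_cs.
- move=> _ v; have [[|e q]] := diagram_connected v (origin d).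
    by move=> /= /eqP->; apply: map_f.
  by move=> /= /andP[/eqP<- _]; apply: map_f.
- have := diagram_spherical D; rewrite size_s even_darts.
  (* The orbit of d is the only region that is not a cell. *)
  have -> : fcard face (dart D) = (size cs).+1.
    rewrite size_map -cardE /n_comp_mem [LHS](cardD1 (froot face d)).
    rewrite {1}/in_mem /= (roots_root (fconnect_sym face_inj)) add1n; congr _.+1.
    apply: eq_card => y; rewrite !inE andbT.
    case: (boolP (y \in cell)) => [y_cell|/(outer_face_unique d_out) dy].
      rewrite andbT; case: eqP => // y_d; case/negP: d_out.
      by rewrite -(@mem_cell_fconnect d y) // y_d connect_root.
    rewrite andbF; apply/negbTE/negP => /andP[y_d /eqP y_root]; case/eqP: y_d.
    by rewrite -y_root; apply/esym/(rootP (fconnect_sym face_inj)).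
  by rewrite maxnE; lia.
Qed.

End Diagram.

(** * From reductions to diagrams *)

Section ClosedWalks.
Variables (T : eqType) (S : rel T) (opp : T -> T).
Hypotheses (Srefl : reflexive S) (Ssym : symmetric S) (Strans : transitive S).

(* An edge path up to the equivalence S, where S stands for having the same
   origin and the extremities are given by darts issued from them. *)
Fixpoint walk (x : T) (p : seq T) (y : T) : bool :=
  if p is d :: p' then S x d && walk (opp d) p' y else S x y.

Definition closed_walk (p : seq T) := p = [::] \/ exists x, walk x p x.

Lemma walk_eql x x' p y : S x x' -> walk x' p y -> walk x p y.
Proof.
case: p => [|d p] /= xx'; first exact: Strans.
by case/andP=> /(Strans xx')->.
Qed.

Lemma walk_eqr x p y y' : S y y' -> walk x p y -> walk x p y'.
Proof.
move=> yy'; elim: p x => [|d p IH] x /=; first by move=> /Strans; apply.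
by case/andP=> -> /IH.
Qed.

Lemma walk_cat x p q y :
  walk x (p ++ q) y <-> exists2 z, walk x p z & walk z q y.
Proof.
elim: p x => [|d p IH] x /=.
  by split=> [w|[z xz]]; [exists x | exact: walk_eql].
split=> [/andP[xd /IH[z wp wq]]|[z /andP[xd wp] wq]]; first by exists z; rewrite ?xd.
by rewrite xd; apply/IH; exists z.
Qed.

Lemma closed_walk_cons d p : closed_walk (d :: p) <-> walk (opp d) p d.
Proof.
split=> [[//|[x /andP[xd w]]]|w]; first exact: walk_eqr xd w.
by right; exists d; rewrite /= Srefl.
Qed.

End ClosedWalks.

(** The corner x between p and q is the origin of a dart of the closed path: the head of q or, when
    q is empty, the head of p. A new dart a attached at this corner is thus equivalent to a dart
    already issued from x. *)
Lemma corner (V T : finType) (origin : T -> V) (opp opp' : T -> T) (S : rel T) x y p q a e :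
  symmetric S -> transitive S ->
  epath origin opp y p x -> epath origin opp x q y ->
  walk S opp' e p a -> walk S opp' a q e -> p ++ q != [::] ->
  exists h, [/\ h \in p ++ q, origin h = x & S a h].
Proof.
move=> Ssym Strans; case: q => [|h q]; last first.
  move=> _ /= /andP[/eqP<- _] _ /andP[ah _] _; exists h; split=> //.
  by rewrite mem_cat inE eqxx orbT.
rewrite cats0 /= => ep /eqP xy wp ae; subst y; case: p ep wp => //= h p.
by move=> /andP[/eqP<- _] /andP[eh _] _; exists h; rewrite mem_head; split=> //; exact: Strans eh.
Qed.

Section Homotopy.
Variables (V T : finType) (origin : T -> V) (opp : T -> T) (cells : seq (seq T)).
Local Notation epath := (epath origin opp).

(* As in Defs.homotopic, but the boundary of each 2-cell is only attached at the
   first dart of the list representing it. *)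
Inductive deform (x y : V) : seq T -> seq T -> Prop :=
| deform_spur p q d :
    epath x p (origin d) -> epath (origin d) q y ->
    deform x y (p ++ [:: d; opp d] ++ q) (p ++ q)
| deform_cell p q c z :
    c \in cells -> epath z c z -> epath x p z -> epath z q y ->
    deform x y (p ++ c ++ q) (p ++ q)
| deform_refl p : epath x p y -> deform x y p p
| deform_sym p q : deform x y p q -> deform x y q p
| deform_trans p q r : deform x y p q -> deform x y q r -> deform x y p r.

Lemma deform_cat x y x' y' a b p q : epath x' a x -> epath y b y' ->
  deform x y p q -> deform x' y' (a ++ p ++ b) (a ++ q ++ b).
Proof.
move=> ea eb; elim=> {p q} [p q d ep eq|p q c z c_cells ec ep eq|p ep|p q _|p q r _ IH1 _ IH2].
- rewrite -!catA !(catA a); apply: deform_spur; apply/epath_cat; eexists; eassumption.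
- rewrite -!catA !(catA a).
  by apply: (@deform_cell _ _ _ _ _ z) => //; apply/epath_cat; eexists; eassumption.
- apply: deform_refl; apply/epath_cat; exists x => //.
  by apply/epath_cat; exists y.
- exact: deform_sym.
- exact: deform_trans IH1 IH2.
Qed.

(** Telescoping: the edges of p are absorbed one after the other. *)
Lemma tree_path_deform base (tree : V -> seq T) x p y :
  (forall v, epath base (tree v) v) ->
  (forall d, deform base (origin (opp d)) (tree (origin d) ++ [:: d])
                    (tree (origin (opp d)))) ->
  epath x p y -> deform base y (tree x ++ p) (tree y).
Proof.
move=> tree_p tree_d; elim: p x => [|d p IH] x /=.
  by move=> /eqP->; rewrite cats0; exact: deform_refl.
case/andP=> /eqP<- ep; apply: deform_trans (IH _ ep).
rewrite -cat1s catA.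
by have := deform_cat (eqxx base : epath base [::] base) ep (tree_d d).
Qed.

End Homotopy.

Section DeformMap.
Variables (V T V' T' : finType) (origin : T -> V) (opp : T -> T).
Variables (origin' : T' -> V') (opp' : T' -> T') (K : V -> V') (J : T -> T').
Hypotheses (Kinj : injective K) (originJ : forall d, origin' (J d) = K (origin d)).
Hypothesis oppJ : forall d, opp' (J d) = J (opp d).

Lemma epath_map x p y :
  epath origin' opp' (K x) (map J p) (K y) = epath origin opp x p y.
Proof.
elim: p x => [|d p IH] x /=; first exact: inj_eq.
by rewrite originJ oppJ originJ (inj_eq Kinj) -IH.
Qed.

Lemma deform_map cells cells' x y p q : {subset map (map J) cells <= cells'} ->
  deform origin opp cells x y p q ->
  deform origin' opp' cells' (K x) (K y) (map J p) (map J q).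
Proof.
move=> sub; elim=> {p q} [p q d ep eq|p q c z c_cells ec ep eq|p ep|p q _|p q r _ IH1 _ IH2].
- rewrite !map_cat /= -oppJ; apply: deform_spur; by rewrite originJ epath_map.
- rewrite !map_cat; apply: (@deform_cell _ _ _ _ _ _ _ _ _ _ (K z)); rewrite ?epath_map //.
  exact/sub/map_f.
- by apply: deform_refl; rewrite epath_map.
- exact: deform_sym.
- exact: deform_trans IH1 IH2.
Qed.

Lemma walk_map (S : rel T') x p y :
  walk S opp' (J x) (map J p) (J y) = walk (relpre J S) opp x p y.
Proof. by elim: p x => [|d p IH] x //=; rewrite oppJ IH. Qed.

End DeformMap.

(* A planar diagram given by the lists of darts around its outer region and
   around its 2-cells.  Instead of following the permutation of the darts around
   a vertex, linked says that any equivalence compatible with the turns made by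
   these lists identifies the darts issued from a vertex; simple connectedness is
   witnessed by a contraction tree, in which every edge from v to v' deforms the
   path tree v into tree v'. *)
Record planar_map m (R : word m -> Prop) (w : word m) (n : nat) := PlanarMap {
  pm_vertex : finType;
  pm_dart : finType;
  pm_origin : pm_dart -> pm_vertex;
  pm_opp : pm_dart -> pm_dart;
  pm_lab : pm_dart -> letter m;
  pm_outer : seq pm_dart;
  pm_cells : seq (seq pm_dart);
  pm_oppK : involutive pm_opp;
  pm_opp_neq : forall d, pm_opp d != d;
  pm_lab_opp : forall d, pm_lab (pm_opp d) = inv_letter (pm_lab d);
  pm_uniq : uniq (flatten (pm_outer :: pm_cells));
  pm_all : forall d, d \in flatten (pm_outer :: pm_cells);
  pm_cells_neq0 : [::] \notin pm_cells;
  pm_outer_neq0 : pm_outer = [::] -> pm_cells = [::];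
  pm_outer_path : exists z, epath pm_origin pm_opp z pm_outer z;
  pm_cells_path : {in pm_cells, forall c, exists z, epath pm_origin pm_opp z c z};
  pm_cells_relator : {in pm_cells, forall c, relator R (map pm_lab c)};
  pm_outer_lab : map pm_lab pm_outer = w;
  pm_card_dart : #|pm_dart| = n.*2;
  pm_euler : #|pm_vertex| + size pm_cells = n.+1;
  pm_linked : forall S : rel pm_dart, reflexive S -> symmetric S -> transitive S ->
    {in pm_outer :: pm_cells, forall c, closed_walk S pm_opp c} ->
    forall d d', pm_origin d = pm_origin d' -> S d d';
  pm_base : pm_vertex;
  pm_tree : pm_vertex -> seq pm_dart;
  pm_tree_path : forall v, epath pm_origin pm_opp pm_base (pm_tree v) v;
  pm_tree_deform : forall d, deform pm_origin pm_opp pm_cells pm_base (pm_origin (pm_opp d))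
    (pm_tree (pm_origin d) ++ [:: d]) (pm_tree (pm_origin (pm_opp d))) }.

Lemma planar_map0 m (R : word m -> Prop) : planar_map R [::] 0.
Proof.
pose o (d : void) : unit := match d with end; pose opp (d : void) : void := d.
apply: (@PlanarMap _ _ _ _ unit void o opp (fun d => match d with end)
  [::] [::] _ _ _ _ _ _ _ _ _ _ _ _ _ _ tt (fun=> [::])) => //.
- by exists tt.
- by rewrite card_void.
- by rewrite card_unit.
Qed.

(** * Adding an edge to a planar map *)

Section Extension.
Variables (m : nat) (V T V' : finType) (origin : T -> V) (opp : T -> T).
Variables (lab : T -> letter m) (x : letter m) (K : V -> V') (va vb : V').
Hypotheses (oppK : involutive opp) (opp_neq : forall d, opp d != d).
Hypothesis lab_opp : forall d, lab (opp d) = inv_letter (lab d).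
Hypothesis Kinj : injective K.

(** The new edge has the darts [None], from va to vb, and [Some None], back from vb to va. The
    embedding K of the old vertices is [Some] when the edge ends in a new leaf and the identity when
    it closes off a cell. *)
Definition ext_old (d : T) : option (option T) := Some (Some d).
Definition ext_opp (d : option (option T)) : option (option T) :=
  match d with
  | None => Some None | Some None => None | Some (Some d) => ext_old (opp d)
  end.
Definition ext_lab (d : option (option T)) : letter m :=
  match d with
  | None => x | Some None => inv_letter x | Some (Some d) => lab d
  end.
Definition ext_origin (d : option (option T)) : V' :=
  match d with None => va | Some None => vb | Some (Some d) => K (origin d) end.

Lemma ext_oppK : involutive ext_opp.
Proof. by case=> [[d|]|] //=; rewrite oppK. Qed.

Lemma ext_opp_neq d : ext_opp d != d.
Proof. by case: d => [[d|]|] //=; exact: opp_neq. Qed.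

Lemma ext_lab_opp d : ext_lab (ext_opp d) = inv_letter (ext_lab d).
Proof. by case: d => [[d|]|] //=; rewrite inv_letterK. Qed.

Lemma ext_old_inj : injective ext_old. Proof. by move=> d e []. Qed.

Lemma ext_epath z p z' :
  epath ext_origin ext_opp (K z) (map ext_old p) (K z') = epath origin opp z p z'.
Proof. exact: (@epath_map _ _ _ _ origin opp ext_origin ext_opp K ext_old Kinj). Qed.

Lemma ext_deform cells cells' z z' p q : {subset map (map ext_old) cells <= cells'} ->
  deform origin opp cells z z' p q ->
  deform ext_origin ext_opp cells' (K z) (K z') (map ext_old p) (map ext_old q).
Proof. exact: (@deform_map _ _ _ _ origin opp ext_origin ext_opp K ext_old Kinj). Qed.

Lemma map_ext_lab p : map ext_lab (map ext_old p) = map lab p.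
Proof. by rewrite -map_comp. Qed.

Lemma ext_uniq s s' :
  perm_eq s' [:: None, Some None & map ext_old s] -> uniq s -> uniq s'.
Proof.
move=> /perm_uniq->; rewrite /= inE /= (map_inj_uniq ext_old_inj) => ->.
by rewrite andbT; apply/andP; split; apply/mapP=> -[].
Qed.

Lemma ext_mem s s' : perm_eq s' [:: None, Some None & map ext_old s] ->
  (forall d, d \in s) -> forall d, d \in s'.
Proof.
move=> ps s_all d; rewrite (perm_mem ps) !inE; case: d => [[d|]|] //=.
by rewrite map_f.
Qed.

Lemma ext_cells_path cells :
  {in cells, forall c, exists z, epath origin opp z c z} ->
  {in map (map ext_old) cells, forall c, exists z, epath ext_origin ext_opp z c z}.
Proof.
move=> cp c' /mapP[c /cp[z ec] ->]; exists (K z).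
by rewrite ext_epath.
Qed.

Lemma ext_cells_relator R cells :
  {in cells, forall c, relator R (map lab c)} ->
  {in map (map ext_old) cells, forall c, relator R (map ext_lab c)}.
Proof. by move=> cr c' /mapP[c /cr rc ->]; rewrite map_ext_lab. Qed.

Lemma ext_cells_neq0 cells : [::] \notin cells -> [::] \notin map (map ext_old) cells.
Proof. by apply: contra => /mapP[[|//]]. Qed.

Lemma ext_closed_walk (S : rel (option (option T))) p :
  reflexive S -> symmetric S -> transitive S ->
  closed_walk S ext_opp (map ext_old p) -> closed_walk (relpre ext_old S) opp p.
Proof.
move=> Srefl Ssym Strans; case: p => [|d p]; first by left.
rewrite /= closed_walk_cons // => w; right; exists d; rewrite /= Srefl.
by rewrite -(@walk_map _ _ opp ext_opp).
Qed.

(* If S is compatible with the extended map then it links the old darts, as soon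
   as it allows to walk around the old outer region. *)
Lemma ext_linked (S : rel (option (option T))) outer cells :
    reflexive S -> symmetric S -> transitive S ->
    (forall S0 : rel T, reflexive S0 -> symmetric S0 -> transitive S0 ->
      {in outer :: cells, forall c, closed_walk S0 opp c} ->
      forall d d', origin d = origin d' -> S0 d d') ->
    closed_walk S ext_opp (map ext_old outer) ->
    {in map (map ext_old) cells, forall c, closed_walk S ext_opp c} ->
  forall d d', origin d = origin d' -> S (ext_old d) (ext_old d').
Proof.
move=> Srefl Ssym Strans link w_outer w_cells.
apply: (link (relpre ext_old S)).
- by move=> d /=.
- by move=> d e /=.
- by move=> d e f /=; exact: Strans.
- move=> c; rewrite inE => /orP[/eqP->|c_cells]; first exact: ext_closed_walk.
  by apply: ext_closed_walk => //; apply: w_cells; exact: map_f.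
Qed.

Lemma ext_corner (S : rel (option (option T))) z y p q a e :
  symmetric S -> transitive S ->
  epath origin opp z p y -> epath origin opp y q z ->
  walk S ext_opp e (map ext_old p) a -> walk S ext_opp a (map ext_old q) e ->
  p ++ q != [::] -> exists2 h, origin h = y & S a (ext_old h).
Proof.
move=> Ssym Strans ep eq wp wq pq.
have [|||h [h_pq oh ah]] := @corner _ _ ext_origin ext_opp ext_opp S (K y) (K z)
  (map ext_old p) (map ext_old q) a e Ssym Strans _ _ wp wq.
- by rewrite ext_epath.
- by rewrite ext_epath.
- by case: (p) pq => //=; case: (q).
move: h_pq oh ah; rewrite -map_cat => /mapP[h0 _ ->] /= /Kinj oh ah.
by exists h0.
Qed.

End Extension.

(** The edge is planted at y, the corner of the outer path between u and v, with a new vertex [None]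
    at its end; edges and vertices both grow by one. *)
Lemma planar_map_leaf m (R : word m -> Prop) u v x n :
  planar_map R (u ++ v) n -> inhabited (planar_map R (u ++ x :: inv_letter x :: v) n.+1).
Proof.
case=> V T o opp lab outer cells oppK opp_neq lab_opp us als cells0 outer0
  [z ez] cells_p cells_r outer_lab cardT euler linked base tree tree_p tree_d.
have [pu [pv [Eouter Eu Ev]]] : exists pu pv,
    [/\ outer = pu ++ pv, map lab pu = u & map lab pv = v].
  exists (take (size u) outer), (drop (size u) outer).
  by rewrite cat_take_drop map_take map_drop outer_lab take_size_cat ?drop_size_cat.
subst outer; have /epath_cat[y epu epv] := ez.
pose J := @ext_old T; pose o' := ext_origin o (@Some V) (Some y) None.
pose opp' := ext_opp opp; pose lab' := ext_lab lab x.
pose outer' := map J pu ++ [:: None; Some None] ++ map J pv.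
pose cells' := map (map J) cells.
pose tree' (w : option V) :=
  if w is Some w' then map J (tree w') else map J (tree y) ++ [:: None].
have perm_s : perm_eq (flatten (outer' :: cells'))
    [:: None, Some None & map J (flatten ((pu ++ pv) :: cells))].
  rewrite /= /outer' perm_sym -[[:: _, _ & _]]/([:: None; Some None] ++ _).
  by rewrite map_cat map_flatten map_cat -!catA perm_catCA.
have Si : injective (@Some V) by move=> ? ? [].
have epathJ := @ext_epath _ _ _ o opp Some (Some y) None Si.
have tree'_p w : epath o' opp' (Some base) (tree' w) w.
  case: w => [w|] /=; first by rewrite epathJ.
  by apply/epath_cat; exists (Some y); rewrite ?epathJ //= !eqxx.
apply: inhabits.
apply: (@PlanarMap _ _ _ _ (option V) (option (option T)) o' opp' lab' outer' cells'
  _ _ _ _ _ _ _ _ _ _ _ _ _ _ (Some base) tree').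
- exact: ext_oppK.
- exact: ext_opp_neq.
- exact: ext_lab_opp.
- exact: ext_uniq perm_s us.
- exact: ext_mem perm_s als.
- exact: ext_cells_neq0.
- by rewrite /outer'; case: (map J pu).
- exists (Some z); apply/epath_cat; exists (Some y); rewrite ?epathJ //=.
  by rewrite !eqxx /= epathJ.
- exact: ext_cells_path.
- exact: ext_cells_relator.
- by rewrite /outer' !map_cat /= !map_ext_lab Eu Ev.
- by rewrite !card_option cardT doubleS.
- by rewrite card_option size_map addSn euler.
- move=> S Srefl Ssym Strans closedS.
  have [|[e we]] : closed_walk S opp' outer' by apply: closedS; rewrite mem_head.
    by rewrite /outer'; case: (map J pu).
  have /(walk_cat _ Srefl Strans)[a wpu /and3P[aN _ wpv]] := we.
  have wpu' := walk_eqr Strans aN wpu.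
  have old := @ext_linked _ _ o opp S (pu ++ pv) cells Srefl Ssym Strans linked.
  have {}old : forall d d', o d = o d' -> S (J d) (J d').
    apply: old; last by move=> c c_cells; apply: closedS; rewrite inE c_cells orbT.
    by right; exists e; rewrite map_cat; apply/(walk_cat _ Srefl Strans); exists None.
  (* Without old darts, the two new ones issue from different vertices and only reflexivity is
     needed. *)
  case: (altP (pu ++ pv =P [::])) => [outer_nil|outer_neq].
    have noT (d : T) : False by have := als d; rewrite outer_nil outer0.
    by case=> [[d|]|] [[d'|]|] // _; try case: (noT d); case: (noT d').
  have [h oh Sh] := @ext_corner _ _ _ o opp Some (Some y) None Si S
    _ _ _ _ _ _ Ssym Strans epu epv wpu' wpv outer_neq.
  case=> [[d|]|] [[d'|]|] //= [].
  + exact: old.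
  + by move=> od; rewrite Ssym; apply: Strans Sh _; apply: old; rewrite oh.
  + by move=> od; apply: Strans Sh _; apply: old; rewrite oh.
- exact: tree'_p.
- case=> [[d|]|] /=.
  + have := @ext_deform _ _ _ o opp Some (Some y) None Si _ cells' _ _ _ _
      (fun _ => id) (tree_d d).
    by rewrite map_cat.
  + rewrite -catA -[map J (tree y) in X in deform _ _ _ _ _ _ X]cats0.
    apply: (@deform_spur _ _ o' opp' cells' (Some base) (Some y) _ [::] None) => //=.
    by rewrite epathJ.
  + by apply: deform_refl; exact: (tree'_p None).
Qed.

(** The edge runs from y to y' alongside pc, the part of the outer path labelled c, and shuts it
    into the cell [b :: map J pc]; edges and cells both grow by one. *)
Lemma planar_map_cell m (R : word m -> Prop) u c v x n :
  relator R (inv_letter x :: c) -> planar_map R (u ++ c ++ v) n ->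
  inhabited (planar_map R (u ++ x :: v) n.+1).
Proof.
move=> rel_c.
case=> V T o opp lab outer cells oppK opp_neq lab_opp us als cells0 outer0
  [z ez] cells_p cells_r outer_lab cardT euler linked base tree tree_p tree_d.
have [pu [pc [pv [Eouter Eu Ec Ev]]]] : exists pu pc pv,
    [/\ outer = pu ++ pc ++ pv, map lab pu = u, map lab pc = c & map lab pv = v].
  exists (take (size u) outer), (take (size c) (drop (size u) outer)),
    (drop (size c) (drop (size u) outer)).
  by rewrite !cat_take_drop !(map_take, map_drop) outer_lab take_size_cat //
    drop_size_cat // take_size_cat ?drop_size_cat.
subst outer; have /epath_cat[y epu /epath_cat[y' epc epv]] := ez.
pose J := @ext_old T; pose o' := ext_origin o id y y'.
pose opp' := ext_opp opp; pose lab' := ext_lab lab x.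
pose a : option (option T) := None; pose b : option (option T) := Some None.
pose outer' := map J pu ++ [:: a] ++ map J pv.
pose cells' := (b :: map J pc) :: map (map J) cells.
pose tree' w := map J (tree w).
have perm_s : perm_eq (flatten (outer' :: cells'))
    [:: None, Some None & map J (flatten ((pu ++ pc ++ pv) :: cells))].
  rewrite /= !map_cat map_flatten; apply/permP => f.
  rewrite /outer' !count_cat /= !count_cat /=.
  move: (count f _) (count f (map J pc)) (count f (map J pv)) (count f _).
  by move: (f a : nat) (f b : nat); clear=> *; lia.
have epathJ := @ext_epath _ _ _ o opp id y y' (@inj_id V).
have deformJ := @ext_deform _ _ _ o opp id y y' (@inj_id V) cells cells'.
have {}deformJ := deformJ _ _ _ _ (fun d h => mem_behead (s := cells') h).
have tree_path := tree_path_deform tree_p tree_d.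
have spur w w' p q : epath o' opp' w p y -> epath o' opp' y q w' ->
    deform o' opp' cells' w w' (p ++ [:: a; b] ++ q) (p ++ q).
  by move=> ep eq; exact: (@deform_spur _ _ o' opp' cells' _ _ _ _ a).
have tree'_p w : epath o' opp' base (tree' w) w by rewrite epathJ.
(* The path tree is kept: a deforms into a b pc through the new cell, then into pc by removing the
   spur a b, and pc is absorbed by the old tree. *)
have tree'_a : deform o' opp' cells' base y' (tree' y ++ [:: a]) (tree' y').
  have := deformJ _ _ _ _ (tree_path _ _ _ epc); rewrite map_cat => dJ.
  apply: deform_trans dJ; apply: deform_trans (spur _ _ _ _ (tree'_p y) _); last first.
    by rewrite epathJ.
  have := @deform_cell _ _ o' opp' cells' base y' (tree' y ++ [:: a]) [::] (b :: map J pc) y'.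
  rewrite !cats0 -catA => dc; apply/deform_sym/dc; rewrite ?mem_head //=.
  - by rewrite eqxx epathJ.
  - by apply/epath_cat; exists y; rewrite //= !eqxx.
apply: inhabits.
apply: (@PlanarMap _ _ _ _ V (option (option T)) o' opp' lab' outer' cells'
  _ _ _ _ _ _ _ _ _ _ _ _ _ _ base tree').
- exact: ext_oppK.
- exact: ext_opp_neq.
- exact: ext_lab_opp.
- exact: ext_uniq perm_s us.
- exact: ext_mem perm_s als.
- by rewrite inE negb_or /=; exact: ext_cells_neq0.
- by rewrite /outer'; case: (map J pu).
- exists z; apply/epath_cat; exists y; rewrite ?epathJ //=.
  by rewrite eqxx /= epathJ.
- move=> c'; rewrite inE => /orP[/eqP->|]; last exact: ext_cells_path.
  by exists y'; rewrite /= eqxx epathJ.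
- move=> c'; rewrite inE => /orP[/eqP->|]; last exact: ext_cells_relator.
  by rewrite /= map_ext_lab Ec.
- by rewrite /outer' !map_cat /= !map_ext_lab Eu Ev.
- by rewrite !card_option cardT doubleS.
- by rewrite /= size_map addnS euler.
- move=> S Srefl Ssym Strans closedS.
  have [|[e we]] : closed_walk S opp' outer' by apply: closedS; rewrite mem_head.
    by rewrite /outer'; case: (map J pu).
  have /(walk_cat _ Srefl Strans)[a' wpu /andP[aa wpv]] := we.
  have {aa}wpu := walk_eqr Strans aa wpu.
  have : closed_walk S opp' (b :: map J pc) by apply: closedS; rewrite !inE eqxx orbT.
  rewrite closed_walk_cons // => wpc.
  have old := @ext_linked _ _ o opp S (pu ++ pc ++ pv) cells Srefl Ssym Strans linked.
  have {}old : forall d d', o d = o d' -> S (J d) (J d').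
    apply: old; last by move=> c' c_cells; apply: closedS; rewrite !inE c_cells !orbT.
    right; exists e; rewrite !map_cat; apply/(walk_cat _ Srefl Strans); exists a => //.
    by apply/(walk_cat _ Srefl Strans); exists b.
  case: (altP (pu ++ pc ++ pv =P [::])) => [outer_nil|outer_neq].
    have noT (d : T) : False by have := als d; rewrite outer_nil outer0.
    (* Here c is empty and the cell is bounded by b alone, so walking around it identifies a and
       b. *)
    have Sab : S a b.
      by case: (pc) wpc outer_nil => //=; case: (pu).
    by case=> [[d|]|] [[d'|]|] // _; try case: (noT d); try case: (noT d'); rewrite // Ssym.
  have [h oh Sh] : exists2 h, o h = y & S a (ext_old h).
    have epcv : epath o opp y (pc ++ pv) z by apply/epath_cat; exists y'.
    apply: (@ext_corner _ _ _ o opp id y y' (@inj_id V) S _ _ _ _ _ _ Ssym Strans epu epcv wpu _ outer_neq).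
    by rewrite map_cat; apply/(walk_cat _ Srefl Strans); exists b.
  have [h' oh' Sh'] : exists2 h, o h = y' & S b (ext_old h).
    have epuc : epath o opp z (pu ++ pc) y' by apply/epath_cat; exists y.
    rewrite catA in outer_neq.
    apply: (@ext_corner _ _ _ o opp id y y' (@inj_id V) S _ _ _ _ _ _ Ssym Strans epuc epv _ wpv outer_neq).
    by rewrite map_cat; apply/(walk_cat _ Srefl Strans); exists a.
  (* Every dart is equivalent to an old dart with the same origin, which reduces the claim to old
     darts. *)
  have rep d : exists2 g, o' d = o g & S d (J g).
    by case: d => [[d|]|]; [exists d | exists h' | exists h].
  move=> d d'; have [g -> Sd] := rep d; have [g' -> Sd'] := rep d'.
  move=> /old Sg; apply: Strans Sd (Strans _ _ _ Sg _); by rewrite Ssym.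
- exact: tree'_p.
- case=> [[d|]|] //=.
  + by have := deformJ _ _ _ _ (tree_d d); rewrite map_cat.
  + have := spur _ _ (tree' y) [::] (tree'_p y) (eqxx y); rewrite cats0 => sp.
    apply: deform_trans sp; apply: deform_sym.
    have eb : epath o' opp' y' [:: b] y by rewrite /= !eqxx.
    have := deform_cat (eqxx base : epath o' opp' base [::] base) eb tree'_a.
    by rewrite /= -catA.
Qed.

Lemma reduces_planar_map m (R : word m -> Prop) n w :
  reduces R n w -> inhabited (planar_map R w n).
Proof.
elim=> {n w} [|n u v x _ [D]|n u c v x rel_c _ [D]].
- exact: inhabits (planar_map0 R).
- exact: planar_map_leaf.
- exact: planar_map_cell D.
Qed.

(** * The permutation with prescribed cycles *)

Lemma uniq_flatten_eq (T : eqType) (L : seq (seq T)) c c' x :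
  uniq (flatten L) -> c \in L -> c' \in L -> x \in c -> x \in c' -> c = c'.
Proof.
elim: L => //= c0 L IH; rewrite cat_uniq => /and3P[_ /hasPn dis uL].
have no d : d \in L -> x \in d -> x \in c0 -> False.
  move=> dL xd xc0; have /dis/negP[] : x \in flatten L by apply/flattenP; exists d.
  exact: xc0.
rewrite !inE => /orP[/eqP->|cL] /orP[/eqP->|c'L] // xc xc'; last exact: IH.
  by case: (no c').
by case: (no c).
Qed.

Lemma uniq_flatten_uniq (T : eqType) (L : seq (seq T)) :
  uniq (flatten L) -> [::] \notin L -> uniq L /\ {in L, forall c, uniq c}.
Proof.
elim: L => //= c0 L IH; rewrite cat_uniq inE negb_or => /and3P[u0 /hasPn dis uL].
case/andP=> c0_neq0 L0; have [uL' ucs] := IH uL L0; split; last first.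
  by move=> c; rewrite inE => /orP[/eqP->|/ucs].
rewrite uL' andbT; case: (c0) c0_neq0 dis => // x c _ dis; apply/negP => cL.
have /dis/negP[] : x \in flatten L by apply/flattenP; exists (x :: c); rewrite ?mem_head.
exact: mem_head.
Qed.

Section Cycles.
Variables (T : finType) (L : seq (seq T)).
Hypotheses (uL : uniq (flatten L)) (L_neq0 : [::] \notin L).
Hypothesis L_all : forall d, d \in flatten L.

Definition cycle_of d := nth [::] L (find (fun c : seq T => d \in c) L).
Definition cycle_face d := next (cycle_of d) d.

Lemma has_cycle d : has (fun c : seq T => d \in c) L.
Proof. by apply/hasP; have /flattenP[c] := L_all d; exists c. Qed.

Lemma mem_cycle_of d : d \in cycle_of d.
Proof. exact: nth_find (has_cycle d). Qed.

Lemma cycle_of_in d : cycle_of d \in L.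
Proof. by apply: mem_nth; rewrite -has_find has_cycle. Qed.

Lemma cycle_ofE c d : c \in L -> d \in c -> cycle_of d = c.
Proof. move=> cL dc; exact: (uniq_flatten_eq uL (cycle_of_in d) cL (mem_cycle_of d)). Qed.

Lemma uniq_cycle_of c : c \in L -> uniq c.
Proof. by case: (uniq_flatten_uniq uL L_neq0) => _; apply. Qed.

Lemma cycle_face_cycle c : c \in L -> fcycle cycle_face c.
Proof.
move=> cL; apply: cycle_from_next; first exact: uniq_cycle_of.
by move=> d dc; rewrite /= /cycle_face (cycle_ofE cL dc).
Qed.

Lemma fconnect_cycle_face c d : c \in L -> d \in c -> fconnect cycle_face d =i c.
Proof. by move=> cL; apply: fconnect_cycle; exact: cycle_face_cycle. Qed.

Lemma cycle_face_inj : injective cycle_face.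
Proof.
move=> d e E; have dc := mem_cycle_of d; have cL := cycle_of_in d.
have ec : e \in cycle_of d.
  have E' : cycle_face e \in cycle_of d by rewrite -E mem_next.
  rewrite -(uniq_flatten_eq uL (cycle_of_in e) cL _ E') ?mem_cycle_of //.
  by rewrite mem_next mem_cycle_of.
move: E; rewrite /cycle_face (cycle_ofE cL ec) => /(congr1 (prev (cycle_of d))).
by rewrite !prev_next ?uniq_cycle_of.
Qed.

Lemma orbit_cycle_face d p : d :: p \in L -> orbit cycle_face d = d :: p.
Proof.
move=> cL; have cyc := cycle_face_cycle cL.
rewrite (fcycle_consE cyc) /orbit; congr traject.
by rewrite (order_cycle cyc) ?mem_head ?uniq_cycle_of.
Qed.

Lemma fcard_cycle_face : fcard cycle_face T = size L.
Proof.
have sym := fconnect_sym cycle_face_inj.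
rewrite /n_comp_mem.
have -> : #|predI (froots cycle_face) (mem T)| = size (map cycle_of (enum (froots cycle_face))).
  by rewrite size_map -cardE; apply: eq_card => d; rewrite !inE andbT.
apply/perm_size/uniq_perm; last 1 first.
- move=> c; apply/mapP/idP => [[d _ ->]|cL]; first exact: cycle_of_in.
  have [d dc] : exists d, d \in c.
    by case: c cL L_neq0 => [->//|d c _ _]; exists d; rewrite mem_head.
  exists (froot cycle_face d); first by rewrite mem_enum; apply: (roots_root sym).
  apply/esym/cycle_ofE; rewrite // -(fconnect_cycle_face cL dc).
  exact: connect_root.
- rewrite map_inj_in_uniq ?enum_uniq // => d e; rewrite !mem_enum => /eqP rd /eqP re E.
  rewrite -rd -re; apply/(rootP sym).
  rewrite -[connect _ d e]/(e \in fconnect cycle_face d).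
  by rewrite (fconnect_cycle_face (cycle_of_in d)) ?mem_cycle_of // E mem_cycle_of.
- by case: (uniq_flatten_uniq uL L_neq0).
Qed.

End Cycles.

(** * Realising a planar map as a diagram *)

Section Realization.
Variables (V T : finType) (origin : T -> V) (opp face : T -> T).
Local Notation epath := (epath origin opp).
Hypothesis oppK : involutive opp.

Lemma homotopic_cat cell x y x' y' a b p q : epath x' a x -> epath y b y' ->
  homotopic origin opp face cell x y p q ->
  homotopic origin opp face cell x' y' (a ++ p ++ b) (a ++ q ++ b).
Proof.
move=> ea eb; elim=> {p q} [p q d ep eq|p q d d_cell ep eq|p ep|p q _|p q r _ IH1 _ IH2].
- rewrite -!catA !(catA a); apply: hom_spur; apply/epath_cat; eexists; eassumption.
- rewrite -!catA !(catA a).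
  by apply: hom_cell => //; apply/epath_cat; eexists; eassumption.
- apply: hom_refl; apply/epath_cat; exists x => //.
  by apply/epath_cat; exists y.
- exact: hom_sym.
- exact: hom_trans IH1 IH2.
Qed.

Lemma deform_homotopic (cell : {pred T}) cells x y p q :
  {in cells, forall c, c != [::]} ->
  {in cells, forall c, {subset c <= cell}} ->
  (forall d p', d :: p' \in cells -> orbit face d = d :: p') ->
  deform origin opp cells x y p q -> homotopic origin opp face cell x y p q.
Proof.
move=> neq0 sub orb; elim=> {p q} [p q d ep eq|p q c z c_cells ec ep eq|p ep|p q _|p q r _ IH1 _ IH2].
- exact: hom_spur.
- case: c c_cells ec => [/neq0//|d c] c_cells /= /andP[/eqP oz _]; subst z.
  have -> : p ++ d :: c ++ q = p ++ orbit face d ++ q by rewrite (orb _ _ c_cells).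
  by apply: hom_cell => //; apply: sub c_cells _ _; rewrite mem_head.
- exact: hom_refl.
- exact: hom_sym.
- exact: hom_trans IH1 IH2.
Qed.

Definition rev_path (p : seq T) := rev (map opp p).

Lemma epath_rev x p y : epath x p y -> epath y (rev_path p) x.
Proof.
elim: p x => [|d p IH] x /=; first by rewrite eq_sym.
case/andP=> /eqP<- /IH ep; rewrite /rev_path /= rev_cons -cats1.
by apply/epath_cat; exists (origin (opp d)); rewrite //= oppK !eqxx.
Qed.

Lemma homotopic_revK cell x p y : epath x p y ->
  homotopic origin opp face cell y y (rev_path p ++ p) [::].
Proof.
elim: p x => [|d p IH] x /=; first by move=> _; apply: hom_refl; rewrite /= eqxx.
case/andP=> _ ep; apply: hom_trans (IH _ ep).
rewrite /rev_path /= rev_cons cat_rcons -{2}[d]oppK.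
rewrite -[_ :: _ :: p]/([:: opp d; opp (opp d)] ++ p).
by apply: hom_spur; first exact: epath_rev.
Qed.

(** With t = [tree x], the loop p is homotopic to t^-1 t p, hence to t^-1 t, hence to the empty
    path. *)
Lemma tree_simply_connected cell base (tree : V -> seq T) :
    (forall v, epath base (tree v) v) ->
    (forall x p, epath x p x -> homotopic origin opp face cell base x (tree x ++ p) (tree x)) ->
  forall x p, epath x p x -> homotopic origin opp face cell x x p [::].
Proof.
move=> tree_p tree_h x p ep; have et := epath_rev (tree_p x).
have h1 := homotopic_cat et (eqxx x : epath x [::] x) (tree_h x p ep).
have h2 := homotopic_revK cell (tree_p x).
have h3 := homotopic_cat (eqxx x : epath x [::] x) ep h2.
rewrite /= !cats0 -?catA in h1 h2 h3.
by apply: hom_trans (hom_sym h3) _; apply: hom_trans h1 h2.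
Qed.

Lemma closed_path_next d p e : epath (origin (opp d)) p (origin e) ->
  path (fun d e => origin (opp d) == origin e) d (rcons p e).
Proof.
elim: p d => [|f p IH] d /=; first by rewrite andbT.
by rewrite eq_sym => /andP[-> /IH].
Qed.

Lemma fcycle_walk (S : rel T) c : reflexive S -> (forall d, S (opp d) (face d)) ->
  fcycle face c -> closed_walk S opp c.
Proof.
move=> Srefl Sface; case: c => [|d p] /=; [by left|right; exists d].
rewrite /= Srefl /=; elim: p {1 3}d H => [|e p IH] f /=.
  by rewrite andbT => /eqP<-.
by case/andP=> /eqP<- /IH->; rewrite Sface.
Qed.

End Realization.

Lemma planar_map_diagram m (R : word m -> Prop) w n : planar_map R w n ->
  exists2 D : diagram R, boundary_label D w & ncells D 1 = n.
Proof.
case=> V T o opp lab outer cells oppK opp_neq lab_opp us als cells0 outer0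
  [z ez] cells_p cells_r outer_lab cardT euler linked base tree tree_p tree_d.
(* In the one-vertex map the empty outer list is not a cycle of [face], so it is dropped; the
   [maxn 1] of [diagram_spherical] makes up for it. *)
pose L := if outer is [::] then [::] else outer :: cells.
pose face := cycle_face L.
pose cell : {pred T} := mem (flatten cells).
have flatL : flatten L = flatten (outer :: cells).
  by rewrite /L; case: (outer) outer0 => // /(_ erefl)->.
have L0 : [::] \notin L by rewrite /L; case: (outer) => // d p; rewrite inE.
have uL : uniq (flatten L) by rewrite flatL.
have L_all d : d \in flatten L by rewrite flatL.
have cellsL c : c \in cells -> c \in L.
  by rewrite /L; case: (outer) outer0 => [/(_ erefl)->|d p _] //; rewrite inE => ->; rewrite orbT.
have face_inj : injective face by exact: cycle_face_inj.
have cell_faceP d : (face d \in cell) = (d \in cell).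
  have memL c e f : c \in cells -> e \in c -> fconnect face e f -> f \in c.
    by move=> /cellsL cL ec; rewrite -(fconnect_cycle_face uL L0 L_all cL ec).
  apply/flattenP/flattenP => -[c c_cells dc]; exists c => //; apply: memL dc _ => //.
    by rewrite fconnect_sym // fconnect1.
  exact: fconnect1.
have closedL c : c \in L -> exists x, epath o opp x c x.
  rewrite /L; case: (outer) ez => // d p ez; rewrite inE => /orP[/eqP->|]; last exact: cells_p.
  by exists z.
have origin_face d : o (face d) = o (opp d).
  have cL := cycle_of_in L_all d; have dc := mem_cycle_of L_all d.
  have [x ec] := closedL _ cL.
  suff /next_cycle/(_ dc)/eqP : cycle (fun d e => o (opp d) == o e) (cycle_of L d) by [].
  by case: cycle_of ec => //= e p /andP[/eqP<-]; exact: closed_path_next.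
have rotation d d' : o d = o d' <-> fconnect (face \o opp) d d'.
  have node_inj : injective (face \o opp) by apply: inj_comp => //; exact: inv_inj.
  split; last first.
    move=> /iter_findex<-; elim: (findex _ _ _) => //= k ->.
    by rewrite origin_face oppK.
  (* The turn from [opp d] to [face d] stays in one orbit of [face \o opp]. All face lists are
     therefore closed walks for the orbit relation, and all darts of a vertex lie in one orbit. *)
  apply: (linked (fconnect (face \o opp))).
  - exact: connect0.
  - exact: fconnect_sym.
  - exact: connect_trans.
  - move=> c c_in; case: (altP (c =P [::])) => [->|c_neq]; first by left.
    apply: (@fcycle_walk _ opp face); first exact: connect0.
      by move=> e; have := fconnect1 (face \o opp) (opp e); rewrite /= oppK.
    apply: cycle_face_cycle => //; move: c_in; rewrite inE => /orP[/eqP E|/cellsL//].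
    by rewrite /L -E; case: (c) c_neq => // e p; rewrite mem_head.
have connected x y : exists p, epath o opp x p y.
  exists (rev_path opp (tree x) ++ tree y); apply/epath_cat; exists base => //.
  exact: epath_rev.
have sconnected : forall x p, epath o opp x p x -> homotopic o opp face cell x x p [::].
  apply: (tree_simply_connected oppK tree_p) => x p ep.
  apply: (@deform_homotopic _ _ _ _ _ _ cells).
  - by move=> c c_cells; apply: contraNneq cells0 => <-.
  - by move=> c c_cells d dc; apply/flattenP; exists c.
  - by move=> d p' /cellsL; exact: orbit_cycle_face.
  - exact: tree_path_deform tree_p tree_d ep.
have outer_cell d : d \in outer -> d \notin cell.
  by move: us; rewrite /= cat_uniq => /and3P[_ /hasPn dis _] d_out; apply/negP => /dis; rewrite d_out.
have spherical : #|V| + maxn 1 (fcard face T) = #|T|./2 + 2.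
  rewrite fcard_cycle_face // cardT doubleK /L.
  by case: (outer) outer0 euler => [/(_ erefl)->|d p _] /=; rewrite ?maxnE /=; lia.
have planar : 0 < #|T| -> exists d, d \notin cell.
  case/card_gt0P=> d _; case Eouter: outer => [|e p].
    by have := als d; rewrite Eouter outer0.
  by exists e; apply: outer_cell; rewrite Eouter mem_head.
have lab_cells d : d \in cell -> relator R (map lab (orbit face d)).
  case/flattenP=> c c_cells dc; have cL := cellsL c c_cells.
  have [i ->] := orbit_rot_cycle (cycle_face_cycle uL L0 L_all cL) (uniq_cycle_of uL L0 cL) dc.
  by rewrite map_rot; apply/relator_rot/cells_r.
have nonempty : 0 < #|V| by apply/card_gt0P; exists base.
exists (@Diagram _ R V T o opp face cell lab oppK opp_neq face_inj rotation cell_faceP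
  connected nonempty spherical planar sconnected lab_opp lab_cells); last by rewrite /= cardT doubleK.
exists outer; last by exists 0; rewrite rot0.
case Eouter: outer => [|d p]; [left|right].
  split=> //=; apply: eq_card0 => d; have := als d; by rewrite Eouter outer0.
exists d; first by apply: outer_cell; rewrite Eouter mem_head.
by rewrite /= (@orbit_cycle_face _ L uL L0 L_all d p) // /L Eouter mem_head.
Qed.

Lemma boundary_label_reduces m (R : word m -> Prop) w n :
  (exists2 D : diagram R, boundary_label D w & ncells D 1 = n) <-> reduces R n w.
Proof.
split=> [[D Dw <-]|/reduces_planar_map[D]]; first exact: diagram_reduces.
exact: planar_map_diagram.
Qed.

(** * Recursive functions *)

(* Recursive functions of all arities at once: the arguments form an environment
   s, in which the i-th variable is nth 0 s i and a bound variable is pushed in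
   front. *)
Definition computable (F : seq nat -> nat) : Prop :=
  forall n, recursive (fun v : n.-tuple nat => F v).

Definition computable_seq (F : seq nat -> seq nat) : Prop :=
  computable (fun s => CodeSeq.code (F s)).

Definition computable_bool (F : seq nat -> bool) : Prop :=
  computable (fun s => F s : nat).

Lemma computable_ext F G : F =1 G -> computable F -> computable G.
Proof. by move=> FG cF n; apply: rec_ext (cF n) => v. Qed.

Lemma computable_const c : computable (fun=> c).
Proof.
elim: c => [|c IH] n; first exact: rec_zero.
by apply: rec_ext (rec_comp rec_succ (fun _ : 'I_1 => IH n)) => v; rewrite /thead tnth_mktuple.
Qed.

Lemma computable_nth i : computable (fun s => nth 0 s i).
Proof.
move=> n; case: (ltnP i n) => [lt_in|le_ni].
  by apply: rec_ext (rec_proj (Ordinal lt_in)) => v; rewrite (tnth_nth 0).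
apply: rec_ext (@rec_zero n) => v; rewrite nth_default // size_tuple.
exact: le_ni.
Qed.

(** Change of variables. The length of the new environment must depend only on that of the old one,
    since [recursive] works with fixed arities. *)
Lemma computable_env (E : seq nat -> seq nat) (k : nat -> nat) F :
  (forall s, size (E s) = k (size s)) ->
  (forall i, computable (fun s => nth 0 (E s) i)) ->
  computable F -> computable (fun s => F (E s)).
Proof.
move=> sizeE cE cF n.
apply: rec_ext (rec_comp (cF (k n)) (fun i : 'I_(k n) => cE i n)) => v.
congr F; apply: (@eq_from_nth _ 0); rewrite size_tuple ?sizeE ?size_tuple // => i lt_i.
by rewrite -(tnth_nth 0 _ (Ordinal lt_i)) tnth_mktuple.
Qed.

Lemma computable_behead F : computable F -> computable (fun s => F (behead s)).
Proof.
apply: (computable_env (k := predn)) => [s|i]; first by rewrite size_behead.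
by apply: computable_ext (computable_nth i.+1) => s; rewrite nth_behead.
Qed.

Lemma computable_behead2 F : computable F -> computable (fun s => F (behead (behead s))).
Proof. by move=> /computable_behead/computable_behead. Qed.

Lemma computable_cons F a :
  computable F -> computable a -> computable (fun s => F (a s :: s)).
Proof.
move=> cF ca; apply: (computable_env (k := succn)) cF => // -[|i] //=.
exact: computable_nth.
Qed.

Lemma computable_app1 (f : nat -> nat) a :
  recursive1 f -> computable a -> computable (fun s => f (a s)).
Proof.
move=> rf ca n.
by apply: rec_ext (rec_comp rf (fun _ : 'I_1 => ca n)) => v; rewrite /thead tnth_mktuple.
Qed.

Lemma computable_prim F G H :
  computable F -> computable G -> (forall s, H (0 :: s) = F s) ->
  (forall x s, H (x.+1 :: s) = G [:: x, H (x :: s) & s]) -> computable H.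
Proof.
move=> cF cG H0 HS [|n].
  by apply: rec_ext (computable_const (H [::]) 0) => v; rewrite tuple0.
by apply: (rec_prim (cF n) (cG n.+2)) => [v|x v]; [exact: H0|exact: HS].
Qed.

Lemma computable_mu F H :
  computable F -> (forall s, F (H s :: s) = 0) ->
  (forall s y, y < H s -> F (y :: s) <> 0) -> computable H.
Proof.
move=> cF FH0 minH n; apply: (rec_mu (cF n.+1)) => v; first exact: FH0.
by move=> y; exact: minH.
Qed.

Fixpoint natrec (b : nat) (g : nat -> nat -> nat) (n : nat) : nat :=
  if n is n'.+1 then g n' (natrec b g n') else b.

Lemma computable_natrec b (g : nat -> nat -> seq nat -> nat) k :
  computable b -> computable (fun s => g (nth 0 s 0) (nth 0 s 1) (behead (behead s))) ->
  computable k -> computable (fun s => natrec (b s) (fun i acc => g i acc s) (k s)).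
Proof.
move=> cb cg ck.
pose H s := natrec (b (behead s)) (fun i acc => g i acc (behead s)) (nth 0 s 0).
apply: (@computable_cons H) => //.
by apply: (computable_prim cb cg).
Qed.

Lemma computable_var k i : computable (fun s => nth 0 (iter k behead s) i).
Proof.
apply: computable_ext (computable_nth (i + k)) => s.
by elim: k i s => [|k IH] i s; rewrite ?addn0 // iterSr -IH nth_behead addnS.
Qed.

Lemma computable_succ a : computable a -> computable (fun s => (a s).+1).
Proof. exact: (computable_app1 (f := succn) rec_succ). Qed.

Lemma computable_pred a : computable a -> computable (fun s => (a s).-1).
Proof.
move=> ca.
apply: (@computable_cons (fun s => (nth 0 s 0).-1)) => //.
apply: (computable_prim (computable_const 0) (computable_nth 0)) => //.
Qed.

Lemma computable_add a b : computable a -> computable b -> computable (fun s => a s + b s).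
Proof.
move=> ca cb; apply: computable_ext (computable_natrec (g := fun _ acc _ => acc.+1) ca _ cb).
  by move=> s; elim: (b s) => [|n IH] /=; rewrite ?addn0 // addnS IH.
exact/computable_succ/computable_nth.
Qed.

Lemma computable_mul a b : computable a -> computable b -> computable (fun s => a s * b s).
Proof.
move=> ca cb; apply: computable_ext (computable_natrec (b := fun=> 0) (g := fun _ acc s => acc + a s) _ _ cb).
- by move=> s; elim: (b s) => [|n IH] /=; rewrite ?muln0 // mulnSr IH.
- exact: computable_const.
- exact: computable_add (computable_nth 1) (computable_behead2 ca).
Qed.

Lemma computable_sub a b : computable a -> computable b -> computable (fun s => a s - b s).
Proof.
move=> ca cb; apply: computable_ext (computable_natrec (g := fun _ acc s => acc.-1) ca _ cb).
- by move=> s; elim: (b s) => [|n IH] /=; rewrite ?subn0 // subnS IH.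
- exact/computable_pred/computable_nth.
Qed.

Lemma computable_exp a b : computable a -> computable b -> computable (fun s => a s ^ b s).
Proof.
move=> ca cb; apply: computable_ext (computable_natrec (b := fun=> 1) (g := fun _ acc s => acc * a s) _ _ cb).
- by move=> s; elim: (b s) => [|n IH] /=; rewrite ?expn0 // expnSr IH.
- exact: computable_const.
- exact: computable_mul (computable_nth 1) (computable_behead2 ca).
Qed.

Lemma computable_double a : computable a -> computable (fun s => (a s).*2).
Proof.
by move=> ca; apply: computable_ext (computable_add ca ca) => s; rewrite addnn.
Qed.

Lemma computable_neg a : computable_bool a -> computable_bool (fun s => ~~ a s).
Proof.
move=> ca; apply: computable_ext (computable_sub (computable_const 1) ca) => s.
by case: (a s).
Qed.

Lemma computable_and a b : computable_bool a -> computable_bool b ->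
  computable_bool (fun s => a s && b s).
Proof. by move=> ca cb; apply: computable_ext (computable_mul ca cb) => s; rewrite mulnb. Qed.

Lemma computable_or a b : computable_bool a -> computable_bool b ->
  computable_bool (fun s => a s || b s).
Proof.
move=> /computable_neg ca /computable_neg cb.
apply: computable_ext (computable_neg (computable_and ca cb)) => s.
by rewrite negb_and !negbK.
Qed.

Lemma computable_imply a b : computable_bool a -> computable_bool b ->
  computable_bool (fun s => a s ==> b s).
Proof.
move=> /computable_neg ca cb; apply: computable_ext (computable_or ca cb) => s.
by rewrite implybE.
Qed.

Lemma computable_leq a b : computable a -> computable b -> computable_bool (fun s => a s <= b s).
Proof.
move=> ca cb.
apply: computable_ext (computable_sub (computable_const 1) (computable_sub ca cb)) => s.
by rewrite -subn_eq0; case: (a s - b s).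
Qed.

Lemma computable_eq a b : computable a -> computable b -> computable_bool (fun s => a s == b s).
Proof.
move=> ca cb; apply: computable_ext (computable_and (computable_leq ca cb) (computable_leq cb ca)) => s.
by rewrite eqn_leq.
Qed.

Lemma computable_if a b c : computable_bool a -> computable b -> computable c ->
  computable (fun s => if a s then b s else c s).
Proof.
move=> ca cb cc; apply: computable_ext (computable_add (computable_mul ca cb)
  (computable_mul (computable_neg ca) cc)) => s.
by case: (a s); rewrite ?mul1n ?mul0n ?addn0.
Qed.

Lemma computable_ifb a b c : computable_bool a -> computable_bool b -> computable_bool c ->
  computable_bool (fun s => if a s then b s else c s).
Proof.
by move=> ca cb cc; apply: computable_ext (computable_if ca cb cc) => s; case: (a s).
Qed.

Lemma computable_odd a : computable a -> computable_bool (fun s => odd (a s)).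
Proof.
move=> ca; apply: computable_ext (computable_natrec (b := fun=> 0) (g := fun _ acc s => 1 - acc) _ _ ca).
- by move=> s; elim: (a s) => [|n IH] //=; rewrite IH; case: odd.
- exact: computable_const.
- exact: computable_sub (computable_const 1) (computable_nth 1).
Qed.

Lemma computable_has (P : nat -> seq nat -> bool) k :
  computable_bool (fun s => P (nth 0 s 0) (behead s)) -> computable k ->
  computable_bool (fun s => has (P^~ s) (iota 0 (k s))).
Proof.
move=> cP ck.
apply: computable_ext (computable_natrec (b := fun=> 0)
  (g := fun i acc s => (0 < acc) || P i s : nat) _ _ ck).
- move=> s; elim: (k s) => [|n IH] //; rewrite -[n.+1]addn1 iotaD has_cat /= orbF addn1 /= IH.
  by case: has.
- exact: computable_const.
- suff cP2 : computable_bool (fun s => P (nth 0 s 0) (behead (behead s))).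
    exact: computable_or (computable_leq (computable_const 1) (computable_nth 1)) cP2.
  (* Variable 1 is the accumulator of the recursion, which P does not see. *)
  apply: (computable_env (E := fun s => nth 0 s 0 :: behead (behead s))
    (k := fun n => n.-2.+1)) cP => [s|[|i]] /=; first by rewrite !size_behead.
    exact: computable_nth.
  by apply: computable_ext (computable_nth i.+2) => s; rewrite !nth_behead.
Qed.

Lemma computable_all (P : nat -> seq nat -> bool) k :
  computable_bool (fun s => P (nth 0 s 0) (behead s)) -> computable k ->
  computable_bool (fun s => all (P^~ s) (iota 0 (k s))).
Proof.
move=> cP ck; apply: computable_ext (computable_neg
  (computable_has (P := fun i s => ~~ P i s) (computable_neg cP) ck)) => s.
by rewrite -all_predC; congr nat_of_bool; apply: eq_all => i /=; rewrite negbK.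
Qed.

(** Unbounded search for the value. It replaces explicit recursive definitions of the operations on
    coded sequences. *)
Lemma computable_graph (G : nat -> seq nat -> bool) H :
  computable_bool (fun s => G (nth 0 s 0) (behead s)) ->
  (forall y s, G y s = (y == H s)) -> computable H.
Proof.
move=> cG GH; apply: (computable_mu (computable_neg cG)) => [s|s y lt_y] /=.
  by rewrite GH eqxx.
by rewrite GH; case: eqP lt_y => // ->; rewrite ltnn.
Qed.

(** * Functions on coded sequences *)

Lemma computable_seq_decode a : computable a -> computable_seq (fun s => CodeSeq.decode (a s)).
Proof. by apply: computable_ext => s; rewrite CodeSeq.decodeK. Qed.

Lemma computable_seq_ext F G : F =1 G -> computable_seq F -> computable_seq G.
Proof. by move=> FG; apply: computable_ext => s; rewrite FG. Qed.

Lemma computable_seq_app (f : seq nat -> nat) F :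
  computable (fun s => f (CodeSeq.decode (nth 0 s 0))) -> computable_seq F ->
  computable (fun s => f (F s)).
Proof.
move=> cf cF; apply: computable_ext (computable_cons cf cF) => s.
by rewrite /= CodeSeq.codeK.
Qed.

Lemma code_cons x l : CodeSeq.code (x :: l) = 2 ^ x * (CodeSeq.code l).*2.+1.
Proof. by []. Qed.

Lemma code_inj : injective CodeSeq.code.
Proof. exact: can_inj CodeSeq.codeK. Qed.

Lemma code_eq0 l : (CodeSeq.code l == 0) = (l == [::]).
Proof. exact: (inj_eq code_inj l [::]). Qed.

(** Computability is proved by following the syntax of the term; functions unknown to the tactic are
    left as goals. *)
Ltac comp_step :=
  lazymatch goal with
  | |- computable (fun=> ?c) => exact (computable_const c)
  | |- computable (fun s => nth 0 s ?i) => exact (computable_var 0 i)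
  | |- computable (fun s => nth 0 (behead s) ?i) => exact (computable_var 1 i)
  | |- computable (fun s => nth 0 (behead (behead s)) ?i) => exact (computable_var 2 i)
  | |- computable (fun s => nth 0 (behead (behead (behead s))) ?i) =>
      exact (computable_var 3 i)
  | |- computable (fun s => nat_of_bool (@?b s)) => change (computable_bool b)
  | |- computable (fun s => S _) => refine (computable_succ _)
  | |- computable (fun s => _ + _) => refine (computable_add _ _)
  | |- computable (fun s => _ - _) => refine (computable_sub _ _)
  | |- computable (fun s => _ * _) => refine (computable_mul _ _)
  | |- computable (fun s => _ ^ _) => refine (computable_exp _ _)
  | |- computable (fun s => _.*2) => refine (computable_double _)
  | |- computable (fun s => if _ then _ else _) => refine (computable_if _ _ _)
  | |- computable_bool (fun s => if _ then _ else _) => refine (computable_ifb _ _ _)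
  | |- computable_bool (fun s => ~~ _) => refine (computable_neg _)
  | |- computable_bool (fun s => _ && _) => refine (computable_and _ _)
  | |- computable_bool (fun s => _ || _) => refine (computable_or _ _)
  | |- computable_bool (fun s => _ ==> _) => refine (computable_imply _ _)
  | |- computable_bool (fun s => odd _) => refine (computable_odd _)
  | |- computable_bool (fun s => leq _ _) => refine (computable_leq _ _)
  | |- computable_bool (fun s => @eq_op _ _ _) => refine (computable_eq _ _)
  | |- computable_bool (fun s => has _ (iota 0 _)) => refine (computable_has _ _)
  | |- computable_bool (fun s => all _ (iota 0 _)) => refine (computable_all _ _)
  end.

Ltac comp := repeat (cbv beta; comp_step).

Lemma ltn_code_cons x l : x < CodeSeq.code (x :: l).
Proof.
rewrite code_cons; apply: leq_trans (ltn_expl x (ltnSn 1)) _.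
by rewrite leq_pmulr.
Qed.

Lemma code_ltn_code_cons x l : CodeSeq.code l < CodeSeq.code (x :: l).
Proof.
rewrite code_cons; apply: leq_trans (_ : (CodeSeq.code l).*2.+1 <= _).
  by rewrite ltnS -addnn leq_addr.
by rewrite leq_pmull // expn_gt0.
Qed.

(** The code of x :: l is 2^x (2 t + 1), where t is the code of l, and this determines x and t; both
    are smaller than the code, which bounds the inner search. *)
Lemma computable_seq_head F : computable_seq F -> computable (fun s => head 0 (F s)).
Proof.
apply: computable_seq_app.
pose G y s := if nth 0 s 0 == 0 then y == 0
  else has (fun t => nth 0 s 0 == 2 ^ y * t.*2.+1) (iota 0 (nth 0 s 0)).
apply: (@computable_graph G); first by rewrite /G; comp.
move=> y s; rewrite /G; move: (nth 0 s 0) => c; rewrite -(CodeSeq.decodeK c).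
case: (CodeSeq.decode c) => [|x l]; rewrite CodeSeq.codeK ?eqxx //.
rewrite -[_ == 0]negbK -lt0n (leq_ltn_trans _ (ltn_code_cons x l)) //=.
apply/hasP/eqP => [[t _ /eqP E]|->].
  have: x :: l = y :: CodeSeq.decode t.
    by apply: code_inj; rewrite !code_cons E CodeSeq.decodeK.
  by case.
by exists (CodeSeq.code l); rewrite // mem_iota code_ltn_code_cons.
Qed.

Lemma computable_seq_behead F : computable_seq F -> computable_seq (fun s => behead (F s)).
Proof.
apply: (@computable_seq_app (fun l => CodeSeq.code (behead l))).
pose G y s := if nth 0 s 0 == 0 then y == 0
  else has (fun x => nth 0 s 0 == 2 ^ x * y.*2.+1) (iota 0 (nth 0 s 0)).
apply: (@computable_graph G); first by rewrite /G; comp.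
move=> y s; rewrite /G; move: (nth 0 s 0) => c; rewrite -(CodeSeq.decodeK c).
case: (CodeSeq.decode c) => [|x l]; rewrite CodeSeq.codeK ?eqxx //.
rewrite -[_ == 0]negbK -lt0n (leq_ltn_trans _ (ltn_code_cons x l)) //=.
apply/hasP/eqP => [[t _ /eqP E]|->].
  have: x :: l = t :: CodeSeq.decode y.
    by apply: code_inj; rewrite !code_cons E CodeSeq.decodeK.
  by case=> _ ->; rewrite CodeSeq.decodeK.
by exists x; rewrite // mem_iota ltn_code_cons.
Qed.

Lemma computable_seq_drop i F : computable i -> computable_seq F ->
  computable_seq (fun s => drop (i s) (F s)).
Proof.
move=> ci cF; apply: computable_ext (computable_natrec
  (g := fun _ acc _ => CodeSeq.code (behead (CodeSeq.decode acc))) cF _ ci).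
  move=> s; elim: (i s) => [|n IH] /=; first by rewrite drop0.
  by rewrite IH CodeSeq.codeK -drop1 drop_drop add1n.
exact: computable_seq_behead (computable_seq_decode (computable_nth 1)).
Qed.

Lemma computable_seq_nth i F : computable_seq F -> computable i ->
  computable (fun s => nth 0 (F s) (i s)).
Proof.
move=> cF ci; apply: computable_ext (computable_seq_head (computable_seq_drop ci cF)) => s.
by rewrite -nth0 nth_drop addn0.
Qed.

Lemma computable_size F : computable_seq F -> computable (fun s => size (F s)).
Proof.
apply: computable_seq_app.
apply: (@computable_mu (fun s => CodeSeq.code (drop (nth 0 s 0) (CodeSeq.decode (nth 0 s 1))))).
- exact: computable_seq_drop (computable_nth 0) (computable_seq_decode (computable_nth 1)).
- by move=> s /=; rewrite drop_size.
- move=> s y lt_y /= /eqP; rewrite code_eq0 => /eqP/(congr1 size)/eqP.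
  by rewrite size_drop subn_eq0 leqNgt lt_y.
Qed.

(** The code is searched for as that of the sequence with the right size and entries. The operations
    [take], [cat] and word inversion are derived from this one. *)
Lemma computable_mkseq (f : nat -> seq nat -> nat) k :
  computable (fun s => f (nth 0 s 0) (behead s)) -> computable k ->
  computable_seq (fun s => mkseq (f^~ s) (k s)).
Proof.
move=> cf ck.
pose G y s := (size (CodeSeq.decode y) == k s) &&
  all (fun i => nth 0 (CodeSeq.decode y) i == f i s) (iota 0 (k s)).
apply: (@computable_graph G) => [|y s].
  have ckb := computable_behead ck.
  have cd : computable_seq (fun s => CodeSeq.decode (nth 0 s 0)).
    exact: computable_seq_decode (computable_nth 0).
  apply: (computable_and (computable_eq (computable_size cd) ckb)).
  apply: (@computable_all (fun i s => nth 0 (CodeSeq.decode (nth 0 s 0)) i == f i (behead s))) ckb.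
  have cd1 := computable_seq_decode (computable_var 1 0).
  refine (computable_eq (computable_seq_nth cd1 (computable_nth 0)) _).
  apply: (computable_env (E := fun s => nth 0 s 0 :: behead (behead s))
    (k := fun n => n.-2.+1)) cf => [s|[|i]] /=; first by rewrite !size_behead.
    exact: computable_nth.
  by apply: computable_ext (computable_nth i.+2) => s; rewrite !nth_behead.
apply/andP/eqP => [[/eqP sz /allP nthP]|->]; last first.
  rewrite CodeSeq.codeK size_mkseq eqxx; split=> //; apply/allP => i.
  by rewrite mem_iota => lt_i; rewrite nth_mkseq.
rewrite -[y in LHS]CodeSeq.decodeK; congr CodeSeq.code.
apply: (@eq_from_nth _ 0) => [|i]; first by rewrite size_mkseq.
by rewrite sz => lt_i; rewrite nth_mkseq // (eqP (nthP i _)) // mem_iota.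
Qed.

Lemma computable_minn a b : computable a -> computable b -> computable (fun s => minn (a s) (b s)).
Proof. by move=> ca cb; apply: computable_if; first exact: computable_leq (computable_succ ca) cb. Qed.

Lemma computable_seq_behead_env F : computable_seq F -> computable_seq (fun s => F (behead s)).
Proof. exact: computable_behead. Qed.

Lemma computable_take i F : computable i -> computable_seq F ->
  computable_seq (fun s => take (i s) (F s)).
Proof.
move=> ci cF; apply: (computable_seq_ext (F := fun s =>
    mkseq (fun j => nth 0 (F s) j) (minn (i s) (size (F s))))).
  move=> s; apply: (@eq_from_nth _ 0) => [|j]; first by rewrite size_mkseq size_take_min.
  by rewrite size_mkseq => lt_j; rewrite nth_mkseq // nth_take // (leq_trans lt_j) ?geq_minl.
apply: (@computable_mkseq (fun j s => nth 0 (F s) j)).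
  exact: computable_seq_nth (computable_seq_behead_env cF) (computable_nth 0).
exact: computable_minn ci (computable_size cF).
Qed.

Lemma computable_cat F1 F2 : computable_seq F1 -> computable_seq F2 ->
  computable_seq (fun s => F1 s ++ F2 s).
Proof.
move=> c1 c2; apply: (computable_seq_ext (F := fun s =>
    mkseq (fun j => if j < size (F1 s) then nth 0 (F1 s) j
                    else nth 0 (F2 s) (j - size (F1 s))) (size (F1 s) + size (F2 s)))).
  move=> s; apply: (@eq_from_nth _ 0) => [|j]; first by rewrite size_mkseq size_cat.
  by rewrite size_mkseq => lt_j; rewrite nth_mkseq // nth_cat.
apply: (@computable_mkseq (fun j s => if j < size (F1 s) then nth 0 (F1 s) j
  else nth 0 (F2 s) (j - size (F1 s)))); last first.
  exact: computable_add (computable_size c1) (computable_size c2).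
have c1' := computable_seq_behead_env c1; have c2' := computable_seq_behead_env c2.
have cs := computable_size c1'.
apply: computable_if.
- exact: computable_leq (computable_succ (computable_nth 0)) cs.
- exact: computable_seq_nth c1' (computable_nth 0).
- exact: computable_seq_nth c2' (computable_sub (computable_nth 0) cs).
Qed.

Lemma computable_seq_cons a F : computable a -> computable_seq F ->
  computable_seq (fun s => a s :: F s).
Proof. by move=> ca cF; apply: computable_mul; comp; do ?[exact: computable_double]. Qed.

Lemma computable_rot i F : computable i -> computable_seq F ->
  computable_seq (fun s => rot (i s) (F s)).
Proof.
by move=> ci cF; apply: (computable_cat (computable_seq_drop ci cF) (computable_take ci cF)).
Qed.

Lemma computable_seq_eq F1 F2 : computable_seq F1 -> computable_seq F2 ->
  computable_bool (fun s => F1 s == F2 s).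
Proof.
move=> c1 c2; apply: computable_ext (computable_eq c1 c2) => s.
by rewrite (inj_eq code_inj).
Qed.

(** The codes 2i and 2i + 1 belong to a letter and its inverse. *)
Definition inv_code (l : nat) : nat := if odd l then l.-1 else l.+1.

Lemma computable_inv_code a : computable a -> computable (fun s => inv_code (a s)).
Proof.
move=> ca; apply: computable_if; first exact: computable_odd.
  exact: computable_pred.
exact: computable_succ.
Qed.

Lemma computable_inv_word F : computable_seq F ->
  computable_seq (fun s => rev (map inv_code (F s))).
Proof.
move=> cF; apply: (computable_seq_ext (F := fun s =>
    mkseq (fun j => inv_code (nth 0 (F s) (size (F s) - j.+1))) (size (F s)))).
  move=> s; apply: (@eq_from_nth _ 0) => [|j]; first by rewrite size_mkseq size_rev size_map.
  rewrite size_mkseq => lt_j; rewrite nth_mkseq // nth_rev size_map //.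
  by rewrite (nth_map 0) // -subSn // subSS leq_subr.
apply: (@computable_mkseq (fun j s => inv_code (nth 0 (F s) (size (F s) - j.+1)))); last exact: computable_size.
have cF' := computable_seq_behead_env cF.
apply: computable_inv_code; apply: (computable_seq_nth cF').
exact: computable_sub (computable_size cF') (computable_succ (computable_nth 0)).
Qed.

Ltac comp_seq_step :=
  lazymatch goal with
  | |- computable (fun s => CodeSeq.code (@?l s)) => change (computable_seq l)
  | |- computable (fun s => nth 0 _ _) => refine (computable_seq_nth _ _)
  | |- computable (fun s => size _) => refine (computable_size _)
  | |- computable (fun s => inv_code _) => refine (computable_inv_code _)
  | |- computable (fun s => ?F (behead s)) => refine (computable_behead _)
  | |- computable_seq (fun=> ?c) => exact (computable_const (CodeSeq.code c))
  | |- computable_seq (fun s => CodeSeq.decode _) => refine (computable_seq_decode _)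
  | |- computable_seq (fun s => take _ _) => refine (computable_take _ _)
  | |- computable_seq (fun s => drop _ _) => refine (computable_seq_drop _ _)
  | |- computable_seq (fun s => rot _ _) => refine (computable_rot _ _)
  | |- computable_seq (fun s => _ ++ _) => refine (computable_cat _ _)
  | |- computable_seq (fun s => _ :: _) => refine (computable_seq_cons _ _)
  | |- computable_seq (fun s => rev (map inv_code _)) => refine (computable_inv_word _)
  | |- computable_seq (fun s => ?F (behead s)) => refine (computable_seq_behead_env _)
  | |- computable_bool (fun s => @eq_op _ _ _) => refine (computable_seq_eq _ _)
  end.

Ltac comp ::= repeat (cbv beta; first [comp_step | comp_seq_step | assumption]).

(** This is the code of L entries all equal to M, the largest among the codes of at most L entries
    bounded by M. *)
Definition code_bound (M L : nat) : nat := natrec 0 (fun _ b => 2 ^ M * b.*2.+1) L.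

Lemma code_le_bound M L l :
  size l <= L -> all (fun x => x <= M) l -> CodeSeq.code l <= code_bound M L.
Proof.
elim: L l => [|L IH] [|x l] //= sz /andP[xM lM].
by rewrite leq_mul ?leq_exp2l // ltnS leq_double IH.
Qed.

Lemma computable_code_bound M L :
  computable M -> computable L -> computable (fun s => code_bound (M s) (L s)).
Proof.
move=> cM cL; apply: (computable_natrec (b := fun=> 0)
  (g := fun _ b s => 2 ^ M s * b.*2.+1)) cL; first by comp.
have cM2 := computable_behead2 cM.
by comp.
Qed.

Lemma drop_cat_size (T : Type) (u v : seq T) j : drop (size u + j) (u ++ v) = drop j v.
Proof. by rewrite addnC -drop_drop drop_size_cat. Qed.

(** * Deciding whether a word bounds a diagram with n edges *)

Section Decision.
Variables (m : nat) (R : word m -> Prop) (chi : nat -> bool).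
Hypothesis rchi : recursive1 (fun x => chi x : nat).
Hypothesis chiP : forall w, chi (word_code w) <-> R w.

Lemma computable_chi a : computable a -> computable_bool (fun s => chi (a s)).
Proof. exact: computable_app1 rchi. Qed.

(** [R] may be infinite, so instead of searching through relators, the rotations of u and their
    inverses are tested for membership. *)
Definition relator_code (u : seq nat) : bool :=
  has (fun k => chi (CodeSeq.code (rot k u))
             || chi (CodeSeq.code (rev (map inv_code (rot k u)))))
      (iota 0 (size u).+1).

Lemma computable_relator_code F :
  computable_seq F -> computable_bool (fun s => relator_code (F s)).
Proof.
move=> cF; rewrite /relator_code; comp.
- by refine (computable_chi _); comp.
- by refine (computable_chi _); comp.
Qed.

Definition valid_code (u : seq nat) : bool :=
  all (fun i => nth 0 u i < m.*2) (iota 0 (size u)).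

Lemma computable_valid_code F :
  computable_seq F -> computable_bool (fun s => valid_code (F s)).
Proof. by move=> cF; rewrite /valid_code; comp. Qed.

(* If w' is obtained from w by replacing a letter with a word c, then c has length
   (size w').+1 - size w. *)
Definition step_code (w w' : seq nat) : bool := valid_code w' &&
  has (fun i =>
    [&& i.+1 < size w, nth 0 w i.+1 == inv_code (nth 0 w i)
      & w' == take i w ++ drop i.+2 w] ||
    (relator_code (inv_code (nth 0 w i) :: take ((size w').+1 - size w) (drop i w')) &&
     (w' == take i w ++ take ((size w').+1 - size w) (drop i w') ++ drop i.+1 w)))
  (iota 0 (size w)).

Lemma computable_step_code F G : computable_seq F -> computable_seq G ->
  computable_bool (fun s => step_code (F s) (G s)).
Proof.
move=> cF cG; rewrite /step_code; comp; first exact: computable_valid_code.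
by refine (computable_relator_code _); comp.
Qed.

(** t lists the codes of the successive words. The empty word has code 0, which is also the value
    read past the end of t. *)
Definition certificate_code (n : nat) (w t : seq nat) : bool :=
  [&& nth 0 t 0 == CodeSeq.code w, nth 0 t n == 0 &
    all (fun i => step_code (CodeSeq.decode (nth 0 t i)) (CodeSeq.decode (nth 0 t i.+1)))
        (iota 0 n)].

(** The inner bound is for the code of a word of length at most 2n, the outer one for the code of a
    list of n + 1 such codes. *)
Definition reduces_code (n : nat) (w : seq nat) : bool :=
  has (fun c => certificate_code n w (CodeSeq.decode c))
      (iota 0 (code_bound (code_bound m.*2 n.*2) n.+1).+1).

Lemma computable_reduces_code a F : computable a -> computable_seq F ->
  computable_bool (fun s => reduces_code (a s) (F s)).
Proof.
move=> ca cF; rewrite /reduces_code /certificate_code; comp.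
- refine (computable_step_code _ _); comp.
- refine (computable_code_bound _ _); comp.
  by refine (computable_code_bound _ _); comp.
Qed.

Let code_word := map (@letter_code m).

Lemma letter_code_inj : injective (@letter_code m).
Proof.
case=> [i a] [j b]; rewrite /letter_code /= => E.
have ab : a = b by have := congr1 odd E; rewrite !oddD !odd_double !oddb.
by subst b; congr pair; apply/val_inj/double_inj/(@addIn a).
Qed.

Lemma inv_code_letter x : inv_code (letter_code x) = letter_code (@inv_letter m x).
Proof.
case: x => i b; rewrite /inv_code /letter_code oddD odd_double oddb.
by case: b => /=; rewrite ?addn1 ?addn0.
Qed.

Lemma inv_code_word w : rev (map inv_code (code_word w)) = code_word (inv_word w).
Proof.
rewrite /code_word /inv_word map_rev -!map_comp; congr rev.
by apply: eq_map => x; exact: inv_code_letter.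
Qed.

Lemma letter_code_lt x : letter_code (x : letter m) < m.*2.
Proof. by case: x => [[i lt_i] b]; rewrite /letter_code /=; case: b; lia. Qed.

Lemma valid_codeP u : reflect (exists w, u = code_word w) (valid_code u).
Proof.
apply: (iffP idP) => [|[w ->]]; last first.
  apply/allP => i; rewrite mem_iota add0n size_map => lt_i.
  have /mapP[x _ ->] : nth 0 (code_word w) i \in code_word w by rewrite mem_nth ?size_map.
  exact: letter_code_lt.
move=> /allP uP; have {}uP : {in u, forall l, l < m.*2}.
  by move=> l /(nthP 0)[i lt_i <-]; apply: uP; rewrite mem_iota.
elim: u uP => [|l u IH] uP; first by exists [::].
have [w ->] := IH (fun k ku => uP k (mem_behead (s := l :: u) ku)).
have lt_l : l./2 < m by have := uP l (mem_head _ _); lia.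
exists ((Ordinal lt_l, odd l) :: w); rewrite /= /letter_code /= addnC.
by rewrite odd_double_half.
Qed.

Lemma cyclic_eq_rotP u v : cyclic_eq u v ->
  exists2 k, k <= size v & u = rot k (v : word m).
Proof.
case=> k ->; case: (leqP k (size u)) => [le_k|/ltnW gt_k]; last first.
  by exists 0 => //; rewrite rot0 rot_oversize.
exists (size u - k); first by rewrite size_rot leq_subr.
by rewrite -{1}(rotK k u) /rotr size_rot.
Qed.

Lemma cyclic_eq_sym u v : cyclic_eq u v -> cyclic_eq (v : word m) u.
Proof. by case/cyclic_eq_rotP=> k _ ->; exists k. Qed.

Lemma relator_codeP u : reflect (relator R u) (relator_code (code_word u)).
Proof.
have chi_rot k : chi (CodeSeq.code (rot k (code_word u))) <-> R (rot k u).
  by rewrite -map_rot; exact: chiP.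
have chi_inv k : chi (CodeSeq.code (rev (map inv_code (rot k (code_word u)))))
    <-> R (inv_word (rot k u)).
  by rewrite -map_rot inv_code_word; exact: chiP.
apply: (iffP hasP) => [[k _ /orP[/chi_rot|/chi_inv] Rr]|[r Rr]].
- by exists (rot k u) => //; left; apply: cyclic_eq_sym; exists k.
- exists (inv_word (rot k u)) => //; right; rewrite inv_wordK.
  by apply: cyclic_eq_sym; exists k.
- case=> /cyclic_eq_rotP[k le_k E]; exists k; rewrite ?mem_iota ?size_map ?ltnS //.
    by apply/orP; left; apply/chi_rot; rewrite -E.
  by apply/orP; right; apply/chi_inv; rewrite -E inv_wordK.
Qed.

Definition reduction_step (w w' : word m) : Prop :=
  (exists u x v, w = u ++ x :: inv_letter x :: v /\ w' = u ++ v) \/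
  (exists u c x v, [/\ relator R (inv_letter x :: c), w = u ++ x :: v & w' = u ++ c ++ v]).

Lemma reduces_succ n w : reduces R n.+1 w <->
  exists2 w', reduction_step w w' & reduces R n w'.
Proof.
split=> [|[w' [[u [x [v [-> ->]]]]|[u [c [x [v [rc -> ->]]]]]]]].
- move En: n.+1 => k r; case: r En => // k' u.
    by move=> v x r [->]; exists (u ++ v) => //; left; exists u, x, v.
  by move=> c v x rc r [->]; exists (u ++ c ++ v) => //; right; exists u, c, x, v.
- exact: reduces_leaf.
- exact: reduces_cell.
Qed.

Lemma step_codeP w t :
  reflect (exists2 w', t = code_word w' & reduction_step w w') (step_code (code_word w) t).
Proof.
have size_code v : size (code_word v) = size v by exact: size_map.
apply: (iffP andP) => [[/valid_codeP[w' ->] /hasP[i]]|[w' -> step]].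
  rewrite mem_iota add0n size_code /= => lt_i body.
  have [u [x [v [Ew szu]]]] : exists u x v, w = u ++ x :: v /\ size u = i.
    case: (w) lt_i => // x0 w0 lt_i.
    exists (take i (x0 :: w0)), (nth x0 (x0 :: w0) i), (drop i.+1 (x0 :: w0)).
    by rewrite -drop_nth // cat_take_drop size_take lt_i.
  subst w i; have Ecat y : code_word (u ++ y) = code_word u ++ code_word y by exact: map_cat.
  have drop_u j y : drop (size u + j) (code_word u ++ y) = drop j y.
    by rewrite -(size_code u) drop_cat_size.
  have nth_u j y : nth 0 (code_word u ++ y) (size u + j) = nth 0 y j.
    by rewrite -(size_code u) nth_cat ltnNge leq_addr addKn.
  have take_u y : take (size u) (code_word u ++ y) = code_word u.
    by rewrite -(size_code u) take_size_cat.
  have nth0_u y : nth 0 (code_word u ++ y) (size u) = nth 0 y 0 by rewrite -(nth_u 0) addn0.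
  have nth1_u y : nth 0 (code_word u ++ y) (size u).+1 = nth 0 y 1 by rewrite -(nth_u 1) addn1.
  have drop1_u y : drop (size u).+1 (code_word u ++ y) = drop 1 y by rewrite -(drop_u 1) addn1.
  have drop2_u y : drop (size u).+2 (code_word u ++ y) = drop 2 y by rewrite -(drop_u 2) addn2.
  exists w' => //; move: body; rewrite Ecat take_u nth0_u nth1_u drop1_u drop2_u /= inv_code_letter drop0.
  case/orP=> [/and3P[lt_u /eqP Ey /eqP Ew']|/andP[rel /eqP Ew']].
    case: v lt_i lt_u Ey Ew' => [|y v] lt_i; first by rewrite size_cat addn1 ltnn.
    move=> _ /= Ey; rewrite (letter_code_inj Ey) drop0 => Ew'.
    left; exists u, x, v; split=> //; apply: (inj_map letter_code_inj).
    by rewrite map_cat.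
  right; move: rel Ew'; set k := _ - _; rewrite -[drop _ _]map_drop -[take _ _]map_take.
  set c := take _ _; rewrite -[_ :: _]/(code_word (inv_letter x :: c)) => /relator_codeP rc Ew'.
  exists u, c, x, v; split=> //; apply: (inj_map letter_code_inj).
  by rewrite !map_cat.
split; first by apply/valid_codeP; exists w'.
apply/hasP; case: step => [[u [x [v [-> ->]]]]|[u [c [x [v [rc -> ->]]]]]].
  exists (size u); first by rewrite mem_iota size_code size_cat /=; lia.
  apply/orP; left; rewrite size_code size_cat /code_word !map_cat /=; apply/and3P; split.
  - lia.
  - by rewrite !nth_cat !size_map ltnn ltnNge leqnSn subnn subSn // subnn /= inv_code_letter.
  - by rewrite take_size_cat ?size_map // -addn2 -(size_map (@letter_code m) u) drop_cat_size /= drop0.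
exists (size u); first by rewrite mem_iota size_code size_cat /=; lia.
have -> : (size (code_word (u ++ c ++ v))).+1 - size (code_word (u ++ x :: v)) = size c.
  by rewrite !size_code !size_cat /=; lia.
apply/orP; right; rewrite /code_word !map_cat /=.
rewrite drop_size_cat ?size_map // take_size_cat ?size_map // take_size_cat ?size_map //.
rewrite nth_cat size_map ltnn subnn /= inv_code_letter.
rewrite -addn1 -(size_map (@letter_code m) u) drop_cat_size /= drop0 eqxx andbT.
exact: (introT (relator_codeP (inv_letter x :: c)) rc).
Qed.

Lemma certificate_reduces n w t :
  certificate_code n (code_word w) t -> reduces R n w.
Proof.
elim: n w t => [|n IH] w t /and3P[/eqP t0 tn /allP steps].
  move: tn; rewrite t0 code_eq0; case: w t0 steps => // _ _ _; exact: reduces_nil.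
have := steps 0; rewrite mem_iota t0 CodeSeq.codeK => /(_ isT) /step_codeP[w' t1 step].
apply/reduces_succ; exists w' => //; apply: (IH w' (behead t)).
rewrite /certificate_code !nth_behead tn -t1 CodeSeq.decodeK eqxx /=.
apply/allP => i; rewrite mem_iota add0n => lt_i.
by rewrite !nth_behead; apply: steps; rewrite mem_iota ltnS.
Qed.

(** A move shortens a word by at most two letters. *)
Lemma reduces_size n w : reduces R n w -> size w <= n.*2.
Proof.
elim=> // {n w} [n u v x _|n u c v x _ _]; rewrite !size_cat /=; lia.
Qed.

Lemma reduces_certificate n w : reduces R n w ->
  exists ws : seq (word m), [/\ size ws = n.+1, all (fun v => size v <= n.*2) ws &
    certificate_code n (code_word w) (map (@word_code m) ws)].
Proof.
elim: n w => [|n IH] w r.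
  exists [:: [::]]; split=> //; rewrite /certificate_code.
  by have := reduces_size r; case: (w).
have [w' step r'] := iffLR (reduces_succ n w) r.
have [ws [sz le_ws /and3P[/eqP w0 wn /allP steps]]] := IH w' r'.
exists (w :: ws); split; first by rewrite /= sz.
  rewrite /= (reduces_size r); apply: sub_all le_ws => v /= le_v; lia.
apply/and3P; split=> //; apply/allP => -[|i]; rewrite mem_iota => lt_i /=.
  rewrite w0 !CodeSeq.codeK; apply/step_codeP; by exists w'.
by apply: steps; rewrite mem_iota -ltnS.
Qed.

Lemma word_code_bound (w : word m) L : size w <= L -> word_code w <= code_bound m.*2 L.
Proof.
move=> le_w; apply: code_le_bound; first by rewrite size_map.
by apply/allP => _ /mapP[x _ ->]; apply/ltnW/letter_code_lt.
Qed.

Lemma reduces_codeP n w : reflect (reduces R n w) (reduces_code n (code_word w)).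
Proof.
apply: (iffP hasP) => [[c _]|/reduces_certificate[ws [sz le_ws cert]]].
  exact: certificate_reduces.
exists (CodeSeq.code (map (@word_code m) ws)); last by rewrite CodeSeq.codeK.
rewrite mem_iota add0n ltnS; apply: code_le_bound; first by rewrite size_map sz.
by apply/allP => _ /mapP[v /(allP le_ws) le_v ->]; exact: word_code_bound.
Qed.

End Decision.

(** * The two implications *)

Lemma min_cells1 m (R : word m -> Prop) w n : min_cells R 1 w n <->
  (reduces R n w /\ forall k, reduces R k w -> n <= k).
Proof.
split=> -[H Hmin]; split.
- exact/boundary_label_reduces.
- by move=> k /boundary_label_reduces; exact: Hmin.
- exact/boundary_label_reduces.
- by move=> k /boundary_label_reduces; exact: Hmin.
Qed.

Lemma solvable_of_dehn m (R : word m -> Prop) :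
  decidable_words R -> computable_dehn R 1 -> solvable_word_problem R.
Proof.
case=> chi rchi chiP [f rf dehn_f].
(* [computable_dehn] specifies f only from 1 on, so f is taken at |w| + 1, which covers the empty
   word too. *)
pose chi' c := has (fun n => reduces_code m chi n (CodeSeq.decode c))
  (iota 0 (f (size (CodeSeq.decode c)).+1).+1).
exists chi' => [|w].
  suff: computable_bool (fun s => chi' (nth 0 s 0)).
    move=> /(_ 1); apply: rec_ext => v; by rewrite /thead (tnth_nth 0).
  rewrite /chi'; comp.
    by refine (computable_reduces_code m rchi _ _); comp.
  by refine (computable_app1 rf _); comp.
have redP n := reduces_codeP chiP n w.
rewrite /chi' /word_code CodeSeq.codeK; split=> [/hasP[n _ /redP]|nc_w].
  exact: reduces_normal_closure.
have ex_red : exists n, reduces_code m chi n (map (@letter_code m) w).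
  by have [n /redP r] := normal_closure_reduces nc_w; exists n.
case: (ex_minnP ex_red) => n /redP rn min_n.
apply/hasP; exists n; last exact/redP.
rewrite mem_iota add0n ltnS size_map.
case: (dehn_f (size w).+1 isT) => _; apply; exists w; split=> //.
by apply/min_cells1; split=> // k /redP; exact: min_n.
Qed.

Lemma dehn_of_solvable m (R : word m -> Prop) :
  decidable_words R -> solvable_word_problem R -> computable_dehn R 1.
Proof.
case=> chi rchi chiP [nc rnc ncP].
pose Q y c := has (fun n => reduces_code m chi n (CodeSeq.decode c)) (iota 0 y.+1).
pose P y x := all (fun c => [&& valid_code m (CodeSeq.decode c),
    size (CodeSeq.decode c) <= x & nc c] ==> Q y c) (iota 0 (code_bound m.*2 x).+1).
have Q_mono y y' c : y <= y' -> Q y c -> Q y' c.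
  move=> le_y /hasP[n]; rewrite mem_iota add0n ltnS => le_n red.
  by apply/hasP; exists n; rewrite // mem_iota add0n ltnS (leq_trans le_n).
have QP y w : reflect (exists2 n, n <= y & reduces R n w) (Q y (word_code w)).
  rewrite /Q /word_code CodeSeq.codeK; apply: (iffP hasP) => -[n].
    by rewrite mem_iota add0n ltnS => le_n /(reduces_codeP chiP) r; exists n.
  by move=> le_n /(reduces_codeP chiP) r; exists n; rewrite // mem_iota add0n ltnS.
have PP y x : reflect (forall w, size w <= x -> normal_closure R w ->
    exists2 n, n <= y & reduces R n w) (P y x).
  apply: (iffP allP) => [allQ w le_w nc_w|redw c _].
    apply/QP/(implyP (allQ (word_code w) _)).
      by rewrite mem_iota add0n ltnS word_code_bound.
    rewrite CodeSeq.codeK size_map le_w; apply/and3P; split=> //; last exact/ncP.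
    by apply/valid_codeP; exists w.
  apply/implyP=> /and3P[/valid_codeP[w Ew] le_w nc_c].
  have Ec : c = word_code w by rewrite -(CodeSeq.decodeK c) Ew.
  rewrite Ec in nc_c *; apply/QP/redw; last exact/ncP.
  by rewrite Ew size_map in le_w.
(* Only finitely many codes are tested, so a common bound is obtained as a maximum along their
   list. *)
have ex_P x : exists y, P y x.
  rewrite /P; elim: (iota 0 _) => [|c s [y /allP IH]]; first by exists 0.
  have [z Pz] : exists z, [&& valid_code m (CodeSeq.decode c),
      size (CodeSeq.decode c) <= x & nc c] ==> Q z c.
    case: (altP and3P) => [[/valid_codeP[w Ew] _ nc_c]|_]; last by exists 0.
    have Ec : c = word_code w by rewrite -(CodeSeq.decodeK c) Ew.
    rewrite Ec in nc_c *; have [n r] := normal_closure_reduces (iffLR (ncP w) nc_c).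
    by exists n; apply/QP; exists n.
  exists (maxn y z); rewrite /=; apply/andP; split.
    by apply: contraTT Pz; rewrite !negb_imply => /andP[-> /=]; apply: contra; apply: Q_mono; rewrite leq_maxr.
  apply/allP => d /IH; case: (_ && _) => //=; apply: Q_mono; exact: leq_maxl.
pose f x := ex_minn (ex_P x).
exists f.
  suff: computable (fun s => f (nth 0 s 0)).
    move=> /(_ 1); apply: rec_ext => v; by rewrite /thead (tnth_nth 0).
  apply: (@computable_mu (fun s => ~~ P (nth 0 s 0) (nth 0 s 1))).
  - rewrite /P /Q; comp.
    + by refine (computable_valid_code _ _); comp.
    + by refine (computable_app1 rnc _); comp.
    + by refine (computable_reduces_code m rchi _ _); comp.
    + by refine (computable_code_bound _ _); comp.
  - by move=> s /=; rewrite /f; case: ex_minnP => y ->.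
  - move=> s y /=; rewrite /f; case: ex_minnP => y0 _ min_y lt_y.
    by case: (boolP (P y _)) => // /min_y; rewrite leqNgt lt_y.
move=> x x_gt0; rewrite /f; case: ex_minnP => y Py min_y; split; last first.
  move=> k [w [nc_w le_w /min_cells1[_ min_k]]].
  by have [n le_n /min_k/leq_trans->] := PP _ _ Py w le_w nc_w.
(* The least bound is attained: 0 by the empty word, and y + 1 by a word on which the bound y
   fails. *)
case: y Py min_y => [|y] Py min_y.
  exists [::]; split=> //; first exact: nc_one.
  by apply/min_cells1; split=> //; exact: reduces_nil.
have nPy : ~~ P y x by apply/negP => /min_y; rewrite ltnn.
have /allPn[c _] := nPy.
rewrite negb_imply => /andP[/and3P[/valid_codeP[w Ew] le_w nc_c]].
have Ec : c = word_code w by rewrite -(CodeSeq.decodeK c) Ew.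
rewrite Ew size_map in le_w; rewrite Ec in nc_c *; move=> nQ.
have nc_w := iffLR (ncP w) nc_c.
exists w; split=> //; apply/min_cells1.
have lt_red k : reduces R k w -> y < k.
  by move=> r; rewrite ltnNge; apply: contra nQ => le_k; apply/QP; exists k.
have [n le_n r] := PP _ _ Py w le_w nc_w.
have En : n = y.+1 by apply/eqP; rewrite eqn_leq le_n lt_red.
by split; [rewrite -En | exact: lt_red].
Qed.

Theorem theorem1p2 (m : nat) (R : word m -> Prop)
    (R_relators : forall r, R r -> r <> [::] /\ cyclically_reduced r)
    (R_decidable : decidable_words R) :
  solvable_word_problem R <-> computable_dehn R 1.
Proof.
split; [exact: dehn_of_solvable | exact: solvable_of_dehn].
Qed.
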